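(* Fix integers $g\ge0$, $n\ge1$ and $k$ with $2g-2+n>0$. The map $\mathbf x\mapsto L_g(\mathbf x,k)$ is piecewise polynomial. More precisely, the set of definition of the map, i.e. $$\Bigl\{\mathbf x\in\mathbb Z^n\ \Big|\ \sum_{i=1}^nx_i=k\cdot(2g-2+n),\ \mathbf x^+>0,\ \mathbf x^-<0\Bigr\},$$ is subdivided by walls with equation $$\Bigl\{\sum_{i\in I}x_i=k\cdot(2g_I-2+|I|)\Bigr\},$$ where $I$ is a subset of $\{1,\dots,n\}$ and $g_I\in\mathbb Z$ satisfies $0\le g_I\le g$. In each region, $L_g(\mathbf x,k)$ equals a polynomial of degree $4g-3+n$ in $\mathbf x$.
   Context: Here $\mathbf x^+$ and $\mathbf x^-$ denote the parts of $\mathbf x$ consisting of the positive and the negative entries (which entries belong to which part is fixed). The walls correspond to cut $k$-leaky graphs with two components, where the ends $x_i$ for $i\in I$ appear in one component, of genus $g_I$. Put $r=2g-2+n$. **Leaky covers.** A tropical curve $\Gamma$ of genus $g$ with $n$ ends is a connected finite graph with positive lengths on bounded edges, $n$ infinite ends labelled $1,\dots,n$, and a genus $g(v)\ge0$ at each vertex; $g=b_1(\Gamma)+\sum_vg(v)$. A metric line graph $T$ is a subdivision of $\mathbb R$ by finitely many vertices, up to translation. A $k$-leaky cover $\pi:\Gamma\to T$ of genus $g$ and degree $\mathbf x$ is a surjective continuous map such that preimages of vertices contain only vertices, each edge $e$ is mapped affinely with positive integer slope $\omega(e)$ (the expansion factor, measured left to right), end $i$ goes to $-\infty$ with $\omega=x_i$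 if $x_i>0$ and to $+\infty$ with $\omega=|x_i|$ if $x_i<0$, and at every vertex $v$ $$d^l_v-d^r_v=k(2g(v)-2+\mathrm{val}(v)),$$ where $d^l_v$ (resp. $d^r_v$) is the sum of expansion factors of flags at $v$ mapping to the left (resp. right). There are no genus $0$ vertices of valence $1$, and over each vertex of $T$ there is a vertex of $\Gamma$ of positive genus or valence greater than $2$. Automorphisms (isomorphisms) are automorphisms (isomorphisms) of sources, fixing end labels, over the identity of $T$. **The number $L_g(\mathbf x,k)$.** It is the degree of the tropical branch morphism sending $\pi:\Gamma\to T$ to $T$, i.e. the weighted number of preimages of a line graph $T$ with $r$ vertices. Fix any such $T$, with distances $s_1,\dots,s_{r-1}>0$ between consecutive vertices; the count is independent of $T$. The weight of a preimage $\pi:\Gamma\to T$ is as follows. Forget the $2$-valent genus $0$ vertices of $\Gamma$; let $E$ be the resulting set of bounded edges and $b=b_1(\Gamma)$. The equations that a basis of the cycles of $\Gamma$ closes up (signed sums of $\omega(e)\ell_e$ vanish) give an integer linear map $\mathbb Z^E\to\mathbb Z^b$; let $I_1$ be the index of its image and $K$ its kernel. Let $I_2$ be the index of the image of $K$ in $\mathbb Z^{r-1}$ under the map taking lengths to $(s_1,\dots,s_{r-1})$. The weight is $\frac1{|\mathrm{Aut}(\pi)|}I_1I_2\left(-\frac1{24}\right)^u$, where $u$ is the number of $1$-valent vertices of genus $1$.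
   Formalization: The printed walls are false for k=2, g=0, n=4; the walls used are sum_I x_i = k(2g_I-2+|I|+c), I proper and nonempty, where c>=1 is the number of cut edges and g_I+c<=g+1. If all x_i have one sign, L is 0 and the zero polynomial is allowed. *)

(* Defs.v *)
From HB Require Import structures.
From mathcomp Require Import all_boot all_order all_algebra all_fingroup.
From mathcomp Require Export mpoly.

Set Implicit Arguments.
Unset Strict Implicit.
Unset Printing Implicit Defensive.

Import Order.TTheory GRing.Theory Num.Theory.

Local Open Scope ring_scope.

(* A metric line graph with r vertices, given by the coordinates t of its
   vertices in the order of the line.  Translating t changes nothing below. *)
Definition line_graph (R : realFieldType) (r : nat) (t : 'I_r -> R) : Prop :=
  forall i j : 'I_r, (i < j)%N -> t i < t j.

(* The data of a map from a tropical curve with n labelled ends to a line graph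
   with r vertices.  The expansion factors are positive, so every bounded edge
   is oriented by the map: lft e and rgt e are the endpoints of e mapped to the
   left and to the right.  An affine map on an edge is determined by the images
   of the endpoints, so the map is recorded by the images pos v of the vertices
   together with the slopes exf e.  The direction and the slope of the end i are
   given by the degree x, see below. *)
Record graph_cover (R : realFieldType) (n r : nat) := GraphCover {
  vert : finType;
  edge : finType;
  gen : vert -> nat;
  lft : edge -> vert;
  rgt : edge -> vert;
  endv : 'I_n -> vert;
  len : edge -> R;
  exf : edge -> nat;
  pos : vert -> 'I_r
}.

Arguments vert {R n r} _.
Arguments edge {R n r} _.
Arguments gen {R n r} _ _.
Arguments lft {R n r} _ _.
Arguments rgt {R n r} _ _.
Arguments endv {R n r} _ _.
Arguments len {R n r} _ _.
Arguments exf {R n r} _ _.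
Arguments pos {R n r} _ _.

Section Covers.

Variables (R : realFieldType) (n r : nat).
Implicit Types (c : graph_cover R n r) (t : 'I_r -> R) (x : 'I_n -> int).

Definition valence c (v : vert c) : nat :=
  (#|[set e | lft c e == v]| + #|[set e | rgt c e == v]|
   + #|[set i | endv c i == v]|)%N.

Definition adjacent c : rel (vert c) := fun u v =>
  [exists e, ((lft c e == u) && (rgt c e == v))
             || ((lft c e == v) && (rgt c e == u))].

(* First Betti number, for c connected. *)
Definition betti c : nat := (#|edge c|.+1 - #|vert c|)%N.

(* A bounded edge lies to the left of its right endpoint, and an end i with
   0 < x i lies to the left of its vertex. *)
Definition left_degree c x (v : vert c) : nat :=
  (\sum_(e | rgt c e == v) exf c e
   + \sum_(i | (endv c i == v) && (0 < x i)%R) absz (x i))%N.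

Definition right_degree c x (v : vert c) : nat :=
  (\sum_(e | lft c e == v) exf c e
   + \sum_(i | (endv c i == v) && (x i < 0)%R) absz (x i))%N.

Definition in_image c t x (y : R) : Prop :=
  [\/ exists v : vert c, y = t (pos c v),
      exists e : edge c, t (pos c (lft c e)) < y < t (pos c (rgt c e)),
      exists2 i, 0 < x i & y < t (pos c (endv c i))
    | exists2 i, x i < 0 & t (pos c (endv c i)) < y].

Record is_leaky_cover (g : nat) (k : int) x t c : Prop := IsLeakyCover {
  lc_connected : forall u v : vert c, connect (@adjacent c) u v;
  lc_genus : g = (betti c + \sum_v gen c v)%N;
  lc_len_gt0 : forall e, 0 < len c e;
  lc_exf_gt0 : forall e, (0 < exf c e)%N;
  lc_affine : forall e,
    (exf c e)%:R * len c e = t (pos c (rgt c e)) - t (pos c (lft c e));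
  (* no interior point of an edge or of an end maps to a vertex *)
  lc_edge_inner : forall e (j : 'I_r),
    ~ (t (pos c (lft c e)) < t j < t (pos c (rgt c e)));
  lc_left_end : forall i (j : 'I_r), 0 < x i -> ~ (t j < t (pos c (endv c i)));
  lc_right_end : forall i (j : 'I_r), x i < 0 -> ~ (t (pos c (endv c i)) < t j);
  lc_surjective : forall y : R, in_image c t x y;
  lc_leaky : forall v : vert c,
    (left_degree x v)%:Z - (right_degree x v)%:Z
    = k * (2 * (gen c v)%:Z - 2 + (valence v)%:Z);
  lc_stable : forall v : vert c, ~ (gen c v = 0%N /\ valence v = 1%N);
  lc_special : forall j : 'I_r,
    exists2 v : vert c, pos c v = j & (0 < gen c v)%N || (2 < valence v)%N
}.

Definition preserves c d (fV : vert c -> vert d) (fE : edge c -> edge d) : bool :=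
  [&& [forall v, gen d (fV v) == gen c v],
      [forall v, pos d (fV v) == pos c v],
      [forall e, lft d (fE e) == fV (lft c e)],
      [forall e, rgt d (fE e) == fV (rgt c e)],
      [forall e, len d (fE e) == len c e],
      [forall e, exf d (fE e) == exf c e]
    & [forall i, endv d i == fV (endv c i)]].

Definition isomorphic c d : Prop :=
  exists (fV : vert c -> vert d) (fE : edge c -> edge d),
    [/\ bijective fV, bijective fE & preserves fV fE].

Definition num_aut c : nat :=
  #|[set f : {perm vert c} * {perm edge c} | preserves f.1 f.2]|.

Definition is_cycle c (z : edge c -> int) : Prop :=
  forall v : vert c, \sum_(e | rgt c e == v) z e = \sum_(e | lft c e == v) z e.

Definition cycle_basis c (b : nat) (z : 'I_b -> edge c -> int) : Prop :=
  (forall i, is_cycle (z i)) /\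
  (forall w : edge c -> int, is_cycle w ->
     exists! a : 'rV[int]_b, forall e, w e = \sum_i a 0 i * z i e).

(* The vertices that are forgotten in the computation of the weight. *)
Definition thin c (v : vert c) : bool := (gen c v == 0%N) && (valence v == 2%N).

Definition continues c : rel (edge c) := fun e f =>
  (rgt c e == lft c f) && thin (rgt c e).

(* e and f are the leftmost and the rightmost segments of one bounded edge of
   the graph obtained by forgetting the thin vertices. *)
Definition bounded_chain c (e f : edge c) : bool :=
  [&& ~~ thin (lft c e), connect (@continues c) e f & ~~ thin (rgt c f)].

(* The bounded edges left after forgetting the thin vertices are indexed by
   their leftmost segments. *)
Definition long_edge c (e : edge c) : bool := [exists f, bounded_chain e f].

(* The class of m in Z^b obtained by evaluating the equations of the cycles z
   at the integral lengths l of the long edges.  Both the expansion factor and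
   the coefficient of a cycle are constant along a chain. *)
Definition cycle_eval c (b : nat) (z : 'I_b -> edge c -> int)
    (l : edge c -> int) : 'rV[int]_b :=
  \row_i \sum_(e | long_edge e) z i e * (exf c e)%:Z * l e.

(* If the cycles close up, the lengths l define a height h of the vertices that
   are not thin, and the distances between consecutive vertices of the line
   graph are the differences of these heights. *)
Definition induced_distances c (l : edge c -> int) (s : 'rV[int]_r.-1) : Prop :=
  exists h : vert c -> int,
    (forall e f, bounded_chain e f ->
       h (rgt c f) - h (lft c e) = (exf c e)%:Z * l e) /\
    (forall (u v : vert c) (j : 'I_r.-1), ~~ thin u -> ~~ thin v ->
       pos c u = j :> nat -> pos c v = j.+1 :> nat -> s 0 j = h v - h u).

(* The subgroup H of Z^d has exactly m cosets. *)
Definition subgroup_index (d : nat) (H : 'rV[int]_d -> Prop) (m : nat) : Prop :=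
  exists a : 'I_m -> 'rV[int]_d, forall v, exists! i, H (v - a i).

(* q is the weight of c; it does not depend on the basis of the cycles. *)
Definition is_weight c (q : rat) : Prop :=
  exists (z : 'I_(betti c) -> edge c -> int) (I1 I2 : nat),
    [/\ cycle_basis z,
        subgroup_index (fun v => exists l, v = cycle_eval z l) I1,
        subgroup_index
          (fun s => exists2 l, cycle_eval z l = 0 & induced_distances l s) I2
      & q = (num_aut c)%:R^-1 * I1%:R * I2%:R
            * (- 24%:R^-1)
              ^+ #|[set v : vert c | (gen c v == 1%N) && (valence v == 1%N)]|].

End Covers.

(* q is the weighted number of isomorphism classes of k-leaky covers of the line
   graph t with 2g - 2 + n vertices: c lists one representative of each class,
   and w lists the weights. *)
Definition is_leaky_number (R : realFieldType) (g n : nat) (k : int)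
    (x : 'I_n -> int) (t : 'I_(2 * g + n - 2) -> R) (q : rat) : Prop :=
  exists (m : nat) (c : 'I_m -> graph_cover R n (2 * g + n - 2)) (w : 'I_m -> rat),
    [/\ forall i, is_leaky_cover g k x t (c i),
        forall d, is_leaky_cover g k x t d -> exists! i, isomorphic d (c i),
        forall i, is_weight (c i) (w i)
      & q = \sum_i w i].

(* P is the fixed set of the labels of the positive entries. *)
Definition in_domain (g n : nat) (k : int) (P : {set 'I_n}) (x : 'I_n -> int) :=
  \sum_i x i = k * (2 * g%:Z - 2 + n%:Z)
  /\ forall i, if i \in P then 0 < x i else x i < 0.

(* Cut a leaky cover along c >= 1 edges of expansion factor 0 into two connected
   components, and let the component with the ends in I have genus h.  Its
   valences count the c flags of the cut edges, so the sum of the leaky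
   conditions over its vertices is the vanishing of wall_form.  The genera h, h'
   of the two components satisfy h + h' + c - 1 = g. *)
Definition wall_form (n : nat) (k : int) (I : {set 'I_n}) (h c : nat)
    (x : 'I_n -> int) : int :=
  \sum_(i in I) x i - k * (2 * h%:Z - 2 + (#|I| + c)%:Z).

(* For I empty or full, wall_form is constant on the domain: no wall. *)
Definition is_wall (g n : nat) (I : {set 'I_n}) (h c : nat) : bool :=
  [&& I != set0, I != setT, (0 < c)%N & (h + c <= g.+1)%N].

Definition off_walls (g n : nat) (k : int) (x : 'I_n -> int) : Prop :=
  forall (I : {set 'I_n}) (h c : nat), is_wall g I h c -> wall_form k I h c x != 0.

(* The component of the complement of the walls that contains y: these
   components are convex, so they are distinguished by the signs. *)
Definition same_region (g n : nat) (k : int) (y x : 'I_n -> int) : Prop :=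
  forall (I : {set 'I_n}) (h c : nat), is_wall g I h c ->
    Num.sg (wall_form k I h c x) = Num.sg (wall_form k I h c y).

(* Main.v *)
Require Import Defs.
From HB Require Import structures.
From mathcomp Require Import all_boot all_order all_algebra all_fingroup.
From mathcomp Require Import mpoly.
From mathcomp Require Import ring zify.

Set Implicit Arguments.
Unset Strict Implicit.
Unset Printing Implicit Defensive.
Import Order.TTheory GRing.Theory Num.Theory.
Local Open Scope ring_scope.

(** Let r = 2g - 2 + n.  The numbers 2 g(v) - 2 + val(v), taken over the vertices v
    of a leaky cover, are nonnegative, vanish for thin vertices and add up to r.
    As each of the r vertices of the line lies below a vertex that is not thin, it
    lies below exactly one, which contributes 1 ([euler_fiber], [nthin_unique]).  So a
    leaky cover is a graph of a combinatorial kind in which neither the degree x nor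
    the position of the vertices of the line occurs ([admissible]), together with
    positive integers on the edges that satisfy the leaky conditions.  These conditions
    say that the expansion factors are a flow whose outflow at every vertex is a given
    affine function of x ([excess]); the lengths are then determined.  Hence the count
    is the same for all line graphs.

    The weight.  For each cover, the product I1 I2 of the two lattice indices is the
    product of the expansion factors of the long edges ([cover_weight]): if A is the
    product of the groups Z/w(e) over the long edges e and Y is the subgroup of the
    residues of height differences, then I1 is the index of Y in A and I2 the order
    of Y.

    The count.  The vertices and edges of covers are bounded in number independently of
    x ([card_edge_bound]).  Numbering them in all possible ways, the orbit-stabilizer
    theorem turns the sum of the weights over the isomorphism classes into a finite
    combination of sums of the monomial prod w(e) over the positive integral flows on
    fixed graphs ([orbit_sum], [leaky_number_polyfun]).

    Flow sums ([flow_sum_polyfun]).  Let C be a circulation with coefficients 0, 1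
    and -1 on a graph.  A polynomial weight is a difference G(f + C) - G(f) with G
    polynomial of degree one more.  Summing over all positive flows f telescopes, and
    what is left is a sum over flows that vanish on some edges of C, hence over the
    positive flows on smaller graphs.  On a forest there is at most one flow with given
    excesses: completing the forest to a spanning tree, the value on an edge is the sum
    of the excesses on one side of the cut that the edge defines.  Only the signs of
    these sums decide whether the flow contributes.  Both sides of the cut are
    connected, and this bounds their Euler characteristic in exactly the way that makes
    the sum one of the wall forms, unless it is constant on the domain ([excess_sign]).
    Hence in each region the flow sum is one polynomial.

    The degree.  The number of long edges plus the first Betti number is at most
    4g - 3 + n ([card_long_edge]).  The sum of the entries of x is constant on the
    domain, so adding a multiple of the difference of the two makes the degree exactly
    4g - 3 + n without changing any value ([adjust_degree]).  The only case in which
    this degree is 0 is that of g = 0 and n = 3; there the polynomial is a constant,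
    which is positive because the vertex with three ends is a cover, unless all ends
    point to the same side and there are no covers at all. *)

(** * Polynomial functions of integers *)

(** Here d is an upper bound on the degree. With polynomials generated in this way,
    substitution and the change of variables below are inductions that never mention
    coefficients. *)
Inductive polyfun (I : Type) : nat -> ((I -> int) -> rat) -> Prop :=
| polyfun_const d a : polyfun d (fun=> a)
| polyfun_var d i : polyfun d.+1 (fun f => (f i)%:~R)
| polyfun_add d p q : polyfun d p -> polyfun d q ->
    polyfun d (fun f => p f + q f)
| polyfun_mul d1 d2 p q : polyfun d1 p -> polyfun d2 q ->
    polyfun (d1 + d2) (fun f => p f * q f)
| polyfun_ext d p q : p =1 q -> polyfun d p -> polyfun d q.

Section Polyfun.
Variable I : Type.
Implicit Types (p q : (I -> int) -> rat) (d : nat).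

Lemma polyfunW d d' p : (d <= d')%N -> polyfun d p -> polyfun d' p.
Proof.
move=> le_d pp; rewrite -(subnKC le_d).
apply: (@polyfun_ext _ _ (fun f => p f * 1)) => [f|]; first by rewrite mulr1.
by apply: polyfun_mul => //; apply: polyfun_const.
Qed.

Lemma polyfun_scale d a p : polyfun d p -> polyfun d (fun f => a * p f).
Proof. by move=> pp; rewrite -[d]add0n; apply: polyfun_mul => //; apply: polyfun_const. Qed.

Lemma polyfun_opp d p : polyfun d p -> polyfun d (fun f => - p f).
Proof.
by move=> pp; apply: polyfun_ext (polyfun_scale (-1) pp) => f; rewrite mulN1r.
Qed.

Lemma polyfun_sum d (J : Type) (s : seq J) (Q : pred J) (F : J -> (I -> int) -> rat) :
  (forall j, Q j -> polyfun d (F j)) ->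
  polyfun d (fun f => \sum_(j <- s | Q j) F j f).
Proof.
move=> pF; elim: s => [|j s IHs].
  by apply: (@polyfun_ext _ _ (fun=> 0)) => [f|]; [rewrite big_nil | apply: polyfun_const].
case: (boolP (Q j)) => [Qj|nQj].
  apply: (@polyfun_ext _ _ (fun f => F j f + \sum_(j <- s | Q j) F j f)) => [f|].
    by rewrite big_cons Qj.
  by apply: polyfun_add => //; apply: pF.
by apply: polyfun_ext IHs => f; rewrite big_cons (negPf nQj).
Qed.

Lemma polyfun_prod (J : Type) (s : seq J) (Q : pred J) (F : J -> (I -> int) -> rat) :
  (forall j, Q j -> polyfun 1 (F j)) ->
  polyfun (count Q s) (fun f => \prod_(j <- s | Q j) F j f).
Proof.
move=> pF; elim: s => [|j s IHs] /=.
  by apply: (@polyfun_ext _ _ (fun=> 1)) => [f|]; [rewrite big_nil | apply: polyfun_const].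
case: (boolP (Q j)) => [Qj|nQj].
  apply: (@polyfun_ext _ _ (fun f => F j f * \prod_(j <- s | Q j) F j f)) => [f|].
    by rewrite big_cons Qj.
  by apply: polyfun_mul => //; apply: pF.
by apply: polyfun_ext IHs => f; rewrite big_cons (negPf nQj).
Qed.

Lemma polyfun_exp d p m : polyfun d p -> polyfun (m * d) (fun f => p f ^+ m).
Proof.
move=> pp; elim: m => [|m IHm].
  by apply: (@polyfun_ext _ _ (fun=> 1)) => [f|]; [rewrite expr0 | apply: polyfun_const].
apply: (@polyfun_ext _ _ (fun f => p f * p f ^+ m)) => [f|]; first by rewrite exprS.
exact: polyfun_mul.
Qed.

Lemma polyfun_comp (J : Type) d (p : (J -> int) -> rat) (F : (I -> int) -> J -> int) :
  polyfun d p -> (forall j, polyfun 1 (fun x => (F x j)%:~R)) ->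
  polyfun d (fun x => p (F x)).
Proof.
move=> pp pF; elim: pp => {d p}.
- by move=> d a; apply: polyfun_const.
- by move=> d j; apply: polyfunW (pF j).
- by move=> d p q _ IHp _ IHq; apply: polyfun_add.
- by move=> d1 d2 p q _ IHp _ IHq; apply: polyfun_mul.
- by move=> d p q epq _ IHp; apply: polyfun_ext IHp => x.
Qed.

(** Antidifferences along an integral vector C with a coordinate C o equal to 1. The
    functions f i - C i * f o do not change when C is added to f, so every polynomial
    is a polynomial in f o with invariant coefficients, and only powers of f o have to
    be summed. *)
Section Antidifference.
Variables (C : I -> int) (o : I).
Hypothesis Co : C o = 1.

Let shift (f : I -> int) : I -> int := fun i => f i + C i.

Inductive shift_expansion : nat -> ((I -> int) -> rat) -> Prop :=
| shift_mono d j p : polyfun d p -> (forall f, p (shift f) = p f) ->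
    shift_expansion (j + d) (fun f => (f o)%:~R ^+ j * p f)
| shift_add d p q : shift_expansion d p -> shift_expansion d q ->
    shift_expansion d (fun f => p f + q f)
| shift_ext d p q : p =1 q -> shift_expansion d p -> shift_expansion d q.

Lemma shift_mul d1 d2 p q : shift_expansion d1 p -> shift_expansion d2 q ->
  shift_expansion (d1 + d2) (fun f => p f * q f).
Proof.
move=> ep eq; elim: ep => {d1 p}.
- move=> d1 j p pp ip; elim: eq => {d2 q}.
  + move=> d2 m q pq iq.
    apply: (@shift_ext _ (fun f => (f o)%:~R ^+ (j + m) * (p f * q f))).
      by move=> f; rewrite exprD; ring.
    rewrite addnACA; apply: shift_mono; first exact: polyfun_mul.
    by move=> f; rewrite ip iq.
  + move=> d q q' _ IHq _ IHq'.
    by apply: shift_ext (shift_add IHq IHq') => f; rewrite mulrDr.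
  + by move=> d q q' e _; apply: shift_ext => f; rewrite e.
- move=> d p p' _ IHp _ IHp'.
  by apply: shift_ext (shift_add IHp IHp') => f; rewrite mulrDl.
- by move=> d p p' e _; apply: shift_ext => f; rewrite e.
Qed.

Lemma polyfun_shift_expansion d p : polyfun d p -> shift_expansion d p.
Proof.
elim=> {d p}.
- move=> d a; apply: (@shift_ext _ (fun f => (f o)%:~R ^+ 0 * a)).
    by move=> f; rewrite mul1r.
  by rewrite -[d]add0n; apply: shift_mono => //; apply: polyfun_const.
- move=> d i.
  apply: (@shift_ext _ (fun f => (f o)%:~R ^+ 1 * (C i)%:~R
      + (f o)%:~R ^+ 0 * ((f i)%:~R + - (C i)%:~R * (f o)%:~R))).
    by move=> f; rewrite expr1 expr0; ring.
  apply: shift_add.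
    by rewrite -add1n; apply: shift_mono => //; apply: polyfun_const.
  rewrite -[d.+1]add0n; apply: shift_mono.
    by apply: polyfun_add; [|apply: polyfun_scale]; apply: polyfun_var.
  by move=> f; rewrite /shift Co !intrD; ring.
- by move=> d p q _ IHp _ IHq; apply: shift_add.
- by move=> d1 d2 p q _ IHp _ IHq; apply: shift_mul.
- by move=> d p q epq _; apply: shift_ext.
Qed.

(** Expanding (a + 1) ^ (j + 1) - a ^ (j + 1) yields (j + 1) a ^ j plus lower powers
    of a, whose antidifferences are available by induction. *)
Lemma power_antidifference m : exists S : nat -> int -> rat,
  forall j, (j < m)%N -> polyfun j.+1 (fun f : I -> int => S j (f o)) /\
    forall a, S j (a + 1) - S j a = a%:~R ^+ j.
Proof.
elim: m => [|m [S HS]]; first by exists (fun _ _ => 0).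
pose T (a : int) : rat := m.+1%:R^-1 * (a%:~R ^+ m.+1
  - \sum_(i < m) 'C(m.+1, i)%:R * S i a).
exists (fun j => if j == m then T else S j) => j; rewrite ltnS leq_eqVlt.
case: eqVneq => [-> _|_ /HS //]; split.
  apply: polyfun_scale; apply: polyfun_add.
    by rewrite -[X in polyfun X]muln1; apply: polyfun_exp; apply: polyfun_var.
  apply: polyfun_opp; apply: polyfun_sum => i _; apply: polyfun_scale.
  by apply: (@polyfunW i.+1); [rewrite ltnS ltnW | case: (HS i (ltn_ord i))].
move=> a; rewrite /T -mulrBr.
have -> : (a + 1)%:~R ^+ m.+1 - \sum_(i < m) 'C(m.+1, i)%:R * S i (a + 1) -
  (a%:~R ^+ m.+1 - \sum_(i < m) 'C(m.+1, i)%:R * S i a) =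
  (a + 1)%:~R ^+ m.+1 - a%:~R ^+ m.+1 -
  (\sum_(i < m) 'C(m.+1, i)%:R * a%:~R ^+ i) :> rat.
  have -> : \sum_(i < m) 'C(m.+1, i)%:R * a%:~R ^+ i
    = \sum_(i < m) ('C(m.+1, i)%:R * S i (a + 1) - 'C(m.+1, i)%:R * S i a) :> rat.
    by apply: eq_bigr => i _; rewrite -mulrBr; case: (HS i (ltn_ord i)) => _ ->.
  by rewrite sumrB; ring.
rewrite [(a + 1)%:~R]intrD [_ + 1%:~R]addrC exprDn !big_ord_recr /=.
under eq_bigr do rewrite expr1n mul1r -mulr_natl.
rewrite !expr1n !mul1r binn mulr1n.
have -> (s b c : rat) : s + b + c - c - s = b by ring.
by rewrite binSn -[_ ^+ m *+ _]mulr_natl mulrA mulVf ?mul1r // pnatr_eq0.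
Qed.

Lemma polyfun_antidifference d p : polyfun d p ->
  exists2 G, polyfun d.+1 G & forall f, G (shift f) - G f = p f.
Proof.
move/polyfun_shift_expansion; elim=> {d p}.
- move=> d j p pp ip; have [S HS] := power_antidifference j.+1.
  have [pS dS] := HS j (ltnSn j).
  exists (fun f => S j (f o) * p f); first by rewrite -addSn; apply: polyfun_mul.
  by move=> f; rewrite ip -mulrBl /shift Co dS.
- move=> d p q _ [G pG dG] _ [K pK dK]; exists (fun f => G f + K f).
    exact: polyfun_add.
  by move=> f; rewrite -dG -dK; ring.
- by move=> d p q epq _ [G pG dG]; exists G => // f; rewrite dG epq.
Qed.
End Antidifference.
End Polyfun.

Lemma polyfun_mpoly (n d : nat) (p : ('I_n -> int) -> rat) : polyfun d p ->
  exists2 P : {mpoly rat[n]}, (msize P <= d.+1)%N &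
    forall x, p x = P.@[fun i => (x i)%:~R].
Proof.
elim=> {d p}.
- move=> d a; exists a%:MP; first by rewrite mmeasureC; case: eqP.
  by move=> x; rewrite mevalC.
- by move=> d i; exists 'X_i; [rewrite msizeX mdeg1 | move=> x; rewrite mevalXU].
- move=> d p q _ [P sP eP] _ [Q sQ eQ]; exists (P + Q).
    by apply: leq_trans (mmeasureD_le _ _ _) _; rewrite geq_max sP.
  by move=> x; rewrite mevalD eP eQ.
- move=> d1 d2 p q _ [P sP eP] _ [Q sQ eQ]; exists (P * Q).
    case: (eqVneq P 0) => [->|P0]; first by rewrite mul0r mmeasure0.
    case: (eqVneq Q 0) => [->|Q0]; first by rewrite mulr0 mmeasure0.
    by rewrite msizeM // -subn1 leq_subLR add1n -addSn -addnS leq_add.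
  by move=> x; rewrite mevalM eP eQ.
- by move=> d p q epq _ [P sP eP]; exists P => // x; rewrite -epq.
Qed.

(** * Flows and spanning trees of directed graphs *)

Section Flow.
Variables (V E : finType) (l r : E -> V).
Implicit Types (c f : E -> int) (D F T : {set E}) (e : E) (u v w : V).

Definition outflow c v : int := \sum_(e | l e == v) c e - \sum_(e | r e == v) c e.

Definition supported c D := forall e, e \notin D -> c e = 0.

Definition joined D : rel V := fun u v =>
  [exists e in D, ((l e == u) && (r e == v)) || ((l e == v) && (r e == u))].

(** Circulations stand for cycles: flows on D are then determined by their outflow. *)
Definition acyclic D :=
  forall c, (forall v, outflow c v = 0) -> supported c D -> forall e, c e = 0.

Definition spanning D := forall u v, connect (joined D) u v.

(** Summation by parts on a graph. For the indicator function H of a set of vertices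
    it computes the flow through a cut; for an arbitrary potential H it says that
    circulations are orthogonal to differences of potentials. *)
Lemma sum_by_parts (A : comPzRingType) (H : V -> A) (c : E -> A) :
  \sum_v H v * (\sum_(e | l e == v) c e - \sum_(e | r e == v) c e)
  = \sum_e c e * (H (l e) - H (r e)).
Proof.
have half (s : E -> V) :
    \sum_v H v * (\sum_(e | s e == v) c e) = \sum_e c e * H (s e).
  under eq_bigr do rewrite big_distrr /=.
  rewrite (exchange_big_dep xpredT) //=; apply: eq_bigr => e _.
  by rewrite (big_pred1 (s e)) 1?mulrC // => v; rewrite eq_sym.
under eq_bigr do rewrite mulrBr.
rewrite sumrB !half -sumrB.
by apply: eq_bigr => e _; rewrite mulrBr.
Qed.

Lemma outflow_cut (S : {set V}) c :
  \sum_(v in S) outflow c v = \sum_e c e * ((l e \in S)%:Z - (r e \in S)%:Z).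
Proof.
rewrite -(sum_by_parts (fun v => (v \in S)%:Z)) big_mkcond.
by apply: eq_bigr => v _; case: (v \in S); rewrite ?mul1r ?mul0r.
Qed.

Lemma outflowD c d v : outflow (fun e => c e + d e) v = outflow c v + outflow d v.
Proof. by rewrite /outflow !big_split /=; ring. Qed.

Lemma outflowZ a c v : outflow (fun e => a * c e) v = a * outflow c v.
Proof. by rewrite /outflow -!big_distrr /=; ring. Qed.

Lemma outflowB c d v : outflow (fun e => c e - d e) v = outflow c v - outflow d v.
Proof. by rewrite /outflow !sumrB; ring. Qed.

Lemma outflow_sum (J : finType) (c : J -> E -> int) v :
  outflow (fun e => \sum_j c j e) v = \sum_j outflow (c j) v.
Proof. by rewrite /outflow sumrB; congr (_ - _); rewrite exchange_big. Qed.

Lemma eq_outflow c d v : c =1 d -> outflow c v = outflow d v.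
Proof. by move=> e; rewrite /outflow; congr (_ - _); apply: eq_bigr. Qed.

Lemma outflow_delta e v :
  outflow (fun e' => (e' == e)%:Z) v = (v == l e)%:Z - (v == r e)%:Z.
Proof.
have half (s : E -> V) : \sum_(e' | s e' == v) (e' == e)%:Z = (v == s e)%:Z.
  rewrite big_mkcond (bigD1 e) //= big1 => [|e' /negPf->]; last by rewrite if_same.
  by rewrite eqxx addr0 eq_sym; case: eqP.
by rewrite /outflow !half.
Qed.

Lemma joined_sym D : ssrbool.symmetric (joined D).
Proof. by move=> u v; apply: eq_existsb => e; rewrite orbC. Qed.

Lemma joined_connect_sym D : connect_sym (joined D).
Proof. exact/sym_connect_sym/joined_sym. Qed.

Lemma joined_sub D F u v :
  D \subset F -> connect (joined D) u v -> connect (joined F) u v.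
Proof.
move=> sDF; apply: connect_sub => a b /exists_inP[e De ab].
by apply/connect1/exists_inP; exists e; rewrite ?(subsetP sDF).
Qed.

Lemma joined_edge D e : e \in D -> connect (joined D) (l e) (r e).
Proof. by move=> De; apply/connect1/exists_inP; exists e; rewrite ?eqxx. Qed.

Lemma closed_connect D (S : {set V}) u v :
  (forall e, e \in D -> (l e \in S) = (r e \in S)) ->
  connect (joined D) u v -> (u \in S) = (v \in S).
Proof.
move=> cl; apply: (@closed_connect _ (joined D) (mem S)) => a b.
by case/exists_inP=> e /cl eq_e /orP[] /andP[/eqP<- /eqP<-].
Qed.

(** The flow runs once through a simple path. That its coefficients do not exceed 1 is
    what makes the sums over flows polynomial rather than quasi-polynomial. *)
Lemma unit_flow D u v : connect (joined D) u v ->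
  exists c, [/\ forall e, `|c e| <= 1, supported c D &
    forall w, outflow c w = (w == u)%:Z - (w == v)%:Z].
Proof.
case/connectP=> p0 p0P ->; case/shortenP: p0P => p pP up _ {p0}.
suff [c [c1 cD cp co]] : exists c, [/\ forall e, `|c e| <= 1, supported c D,
    forall e, c e != 0 -> (l e \in u :: p) && (r e \in u :: p) &
    forall w, outflow c w = (w == u)%:Z - (w == last u p)%:Z] by exists c.
elim: p u pP up => [|a p IHp] u /=.
  move=> _ _; exists (fun=> 0); split=> // w; last by rewrite /outflow !big1 ?subrr.
case/andP=> /exists_inP[e De ua] pP /andP[nu up].
have [c [c1 cD cp co]] := IHp a pP up.
have ce0 : c e = 0.
  apply/eqP; apply: contraNT nu => /cp.
  by case/orP: ua => /andP[/eqP-> /eqP->] /andP[].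
pose s : int := if (l e == u) && (r e == a) then 1 else -1.
exists (fun e' => s * (e' == e)%:Z + c e'); split.
- move=> e'; case: eqVneq => [->|_]; last by rewrite mulr0 add0r.
  by rewrite ce0 /s; case: ifP.
- move=> e' nD; rewrite cD // addr0; case: eqVneq => [ee|_]; last by rewrite mulr0.
  by rewrite ee De in nD.
- move=> e'; case: (eqVneq e' e) => [->|_].
    by move=> _; case/orP: ua => /andP[/eqP-> /eqP->]; rewrite !inE !eqxx /= ?orbT.
  rewrite mulr0 add0r => /cp /andP[x1 x2].
  by rewrite in_cons x1 orbT in_cons x2 orbT.
- move=> w; rewrite outflowD outflowZ outflow_delta co /s.
  case: ifP ua => [/andP[/eqP-> /eqP->] _ | _ /= /andP[/eqP-> /eqP->]]; ring.
Qed.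

Lemma acyclicS D F : D \subset F -> acyclic F -> acyclic D.
Proof.
move=> sDF aF c c0 cD; apply: aF => // e; apply: contraNeq => ce.
by apply: (subsetP sDF); apply: contraNT ce => /cD ->.
Qed.

(** An edge between two components closes no cycle: summing the outflow of a
    circulation over the component of l e isolates its value at e. *)
Lemma acyclicU1 F e : acyclic F -> ~~ connect (joined F) (l e) (r e) ->
  acyclic (e |: F).
Proof.
move=> aF ne c c0 cF.
pose S := [set v | connect (joined F) (l e) v].
have ce : c e = 0.
  have := outflow_cut S c; rewrite big1 => [/esym|v _]; last exact: c0.
  rewrite (bigD1 e) //= big1 => [|e' ne'].
    by rewrite addr0 !inE connect0 (negPf ne) subr0 mulr1.
  case: (boolP (e' \in F)) => [Fe'|nF]; last by rewrite cF ?mul0r // !inE negb_or ne'.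
  rewrite !inE (same_connect_r (@joined_connect_sym F) (joined_edge Fe')).
  by rewrite subrr mulr0.
apply: aF => // e' nF; case: (eqVneq e' e) => [->|ne'] //.
by apply: cF; rewrite !inE negb_or ne'.
Qed.

Lemma acyclic_bridge F e : acyclic F -> e \in F ->
  ~~ connect (joined (F :\ e)) (l e) (r e).
Proof.
move=> aF Fe; apply/negP=> /unit_flow[c [_ cF co]].
have ce : c e = 0 by apply: cF; rewrite !inE eqxx.
suff /(_ e) : forall e', c e' - (e' == e)%:Z = 0 by rewrite ce eqxx.
apply: aF => [v|e' nF].
  by rewrite outflowB outflow_delta co subrr.
rewrite cF; last by rewrite !inE negb_and nF orbT.
by case: eqVneq => [ee|_]; rewrite ?subr0 // ee Fe in nF.
Qed.

Lemma spanning_tree D : acyclic D -> spanning setT ->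
  exists T, [/\ D \subset T, acyclic T & spanning T].
Proof.
move=> + spanE; move: {2}#|~: D| (leqnn #|~: D|) => m.
elim: m D => [|m IHm] D.
  rewrite leqn0 cards_eq0 => /eqP D0 aD; exists D; split=> // u v.
  by apply: joined_sub (spanE u v); rewrite -[D]setCK D0 setC0.
move=> leD aD.
case: (pickP (fun e => ~~ connect (joined D) (l e) (r e))) => [e ne|noe].
  have nDe : e \notin D by apply: contra ne => /joined_edge.
  have [|T [sT aT spT]] := IHm (e |: D) _ (acyclicU1 aD ne).
    rewrite -ltnS; apply: leq_trans leD; apply: proper_card.
    by apply/properP; split; [rewrite setCS subsetUr | exists e; rewrite !inE ?eqxx].
  by exists T; split=> //; apply: subset_trans sT; apply: subsetUr.
exists D; split=> // u v; have /connect_sub := spanE u v; apply=> a b.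
case/exists_inP=> e _ /orP[] /andP[/eqP<- /eqP<-].
  exact/negPn/negbT/noe.
by rewrite joined_connect_sym; apply/negPn/negbT/noe.
Qed.

Lemma acyclic0 : acyclic set0.
Proof. by move=> c _ c0 e; apply: c0; rewrite inE. Qed.

(** After an edge e has been removed, its ends lie in different components, so a
    solution for the other edges can be shifted on one of them. *)
Lemma potential F (c : E -> int) : acyclic F ->
  exists H : V -> int, forall e, e \in F -> H (r e) - H (l e) = c e.
Proof.
have [m] := ubnP #|F|; elim: m F => // m IHm F leF aF.
have [->|[e Fe]] := set_0Vmem F; first by exists (fun=> 0) => e; rewrite inE.
have [||H HF] := IHm (F :\ e).
- by rewrite (cardsD1 e) Fe in leF.
- by apply: acyclicS aF; apply: subsetDl.
have nb := acyclic_bridge aF Fe.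
pose S v := connect (joined (F :\ e)) (l e) v.
exists (fun v => H v + if S v then 0 else c e - (H (r e) - H (l e))) => e' Fe'.
case: (eqVneq e' e) => [->|ne]; first by rewrite /S connect0 (negPf nb); ring.
have Fe'e : e' \in F :\ e by rewrite !inE ne.
rewrite -(HF e' Fe'e) /S (same_connect_r (@joined_connect_sym _) (joined_edge Fe'e)).
by case: ifP => _; ring.
Qed.

Lemma odd_absz_add (a b : int) : odd `|a + b| = odd `|a| (+) odd `|b|.
Proof. lia. Qed.

(** Potentials modulo 2 are counted in two ways: they are determined by the value at o
    and the differences along the edges of T, all of which are arbitrary. *)
Lemma tree_card T (o : V) : acyclic T -> spanning T -> #|V| = #|T|.+1.
Proof.
move=> aT spT; pose K := {e | e \in T}.
pose phi (H : {ffun V -> bool}) : {ffun K -> bool} * bool :=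
  ([ffun e => H (r (val e)) (+) H (l (val e))], H o).
have inj_phi : injective phi.
  move=> H H' [/ffunP eqH eqo]; apply/ffunP=> v.
  have: (o \in [set v | H v == H' v]) = (v \in [set v | H v == H' v]).
    apply: closed_connect (spT o v) => e Te; rewrite !inE.
    by have:= eqH (Sub e Te); rewrite !ffunE /=; case: (H _); case: (H _); case: (H' _); case: (H' _).
  by rewrite !inE eqo eqxx => /esym/eqP.
have surj_phi : [set: {ffun K -> bool} * bool] \subset phi @: setT.
  apply/subsetP=> -[a b] _.
  have [H HT] := potential (fun e => (if insub e is Some k then a k else false)%:Z) aT.
  apply/imsetP; exists [ffun v => odd `|H v| (+) odd `|H o| (+) b] => //.
  congr pair; last by rewrite ffunE addbb.
  apply/ffunP=> -[e Te]; rewrite !ffunE /=.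
  have := HT e Te; rewrite insubT /= => He.
  have : odd `|H (r e)| = odd `|H (l e)| (+) a (Sub e Te).
    by rewrite -(subrK (H (l e)) (H (r e))) He odd_absz_add addbC; case: (a _).
  by move=> ->; case: (odd _); case: (odd _); case: (a _); case: b.
have : #|[set: {ffun K -> bool} * bool]| = #|{ffun V -> bool}|.
  rewrite -[RHS]cardsT -(card_imset _ inj_phi).
  by apply/eqP; rewrite eqn_leq !subset_leq_card ?surj_phi ?subsetT.
rewrite cardsT card_prod !card_ffun card_bool card_sig -expnSr => /eqP.
by rewrite eqn_exp2l // => /eqP <-.
Qed.
End Flow.

(** * Telescoping sums over the positive flows *)

Section FlowSum.
Variables (V E : finType) (l r : E -> V).
Implicit Types (b : V -> int) (f : {ffun E -> int}) (D F T Z : {set E}) (e : E) (v : V).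
Local Notation outflow := (outflow l r).
Local Notation acyclic := (acyclic l r).
Local Notation joined := (joined l r).

(** A set S of vertices is determined by the edges of F that it cuts and by its trace
    on A, because the symmetric difference of two sets with equal data satisfies the
    hypothesis. So there are at most 2 ^ (#|F| + #|A|) sets. *)
Lemma card_vertices_le F (A : {set V}) :
  (forall S : {set V}, (forall e, e \in F -> (l e \in S) = (r e \in S)) ->
     [disjoint S & A] -> S = set0) ->
  (#|V| <= #|F| + #|A|)%N.
Proof.
move=> triv.
pose phi (S : {set V}) := ([set e in F | (l e \in S) != (r e \in S)], S :&: A).
have inj_phi : injective phi.
  move=> S S' [/setP eF /setP eA].
  have : [set v | (v \in S) != (v \in S')] = set0.
    apply: triv => [e Fe|].
      have := eF e; rewrite !inE Fe /=.
      by case: (l e \in S); case: (r e \in S); case: (l e \in S'); case: (r e \in S').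
    rewrite disjoint_subset; apply/subsetP=> v; rewrite !inE; apply: contra => Av.
    by have := eA v; rewrite !inE Av !andbT => ->.
  move=> /setP e0; apply/setP=> v; have := e0 v.
  by rewrite !inE => /negbFE/eqP.
have : (#|phi @: setT| <= #|setX (powerset F) (powerset A)|)%N.
  apply: subset_leq_card; apply/subsetP=> _ /imsetP[S _ ->].
  rewrite inE /= !powersetE subsetIr andbT.
  by apply/subsetP=> e; rewrite inE => /andP[].
rewrite (card_imset _ inj_phi) cardsX !card_powerset -expnD -powersetT card_powerset.
by rewrite leq_exp2l // cardsT.
Qed.

Definition cut_side T e := [set v | connect (joined (T :\ e)) (l e) v].

(** The edge e is the only edge of T that leaves the side of its cut. *)
Lemma tree_flow T (c : E -> int) e : acyclic T -> supported c T -> e \in T ->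
  c e = \sum_(v in cut_side T e) outflow c v.
Proof.
move=> aT cT Te; rewrite outflow_cut (bigD1 e) //= big1 => [|e' ne'].
  by rewrite addr0 !inE connect0 (negPf (acyclic_bridge aT Te)) subr0 mulr1.
case: (boolP (e' \in T)) => [Te'|nT]; last by rewrite cT ?mul0r.
have Te'e : e' \in T :\ e by rewrite !inE ne'.
by rewrite !inE (same_connect_r (@joined_connect_sym _ _ l r _) (joined_edge _ _ Te'e)) subrr mulr0.
Qed.

Definition flow D b f :=
  [forall e, if e \in D then 0 < f e else f e == 0] && [forall v, outflow f v == b v].

(** A finite range for the flows, so that sums over flows make sense; it contains all
    of them when B is large enough ([flow_in_box]). *)
Definition box B : seq {ffun E -> int} :=
  [seq [ffun e => (h e)%:Z] | h : {ffun E -> 'I_B}].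

Definition flow_sum B D b (w : (E -> int) -> rat) : rat :=
  \sum_(f <- box B | flow D b f) w f.

Lemma flowP D b f :
  reflect [/\ forall e, e \in D -> 0 < f e, supported f D & forall v, outflow f v = b v]
          (flow D b f).
Proof.
apply: (iffP andP) => [[/forallP fD /forallP fb]|[fD f0 fb]]; split.
- by move=> e De; have := fD e; rewrite De.
- by move=> e De; have := fD e; rewrite (negPf De) => /eqP.
- by move=> v; apply/eqP.
- by apply/forallP=> e; case: ifP => [|/negbT] De; [exact: fD | rewrite f0].
- by apply/forallP=> v; rewrite fb.
Qed.

Lemma box_uniq B : uniq (box B).
Proof.
rewrite map_inj_uniq ?enum_uniq // => h h' /ffunP eh; apply/ffunP=> e.
by have := eh e; rewrite !ffunE => -[]; apply: val_inj.
Qed.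

Lemma mem_box B f : (f \in box B) = [forall e, 0 <= f e < B%:Z].
Proof.
apply/mapP/forallP => [[h _ ->] e|fB].
  by rewrite ffunE ltz_nat ltn_ord.
have fe e : (`|f e| < B)%N by have := fB e; lia.
exists [ffun e => Ordinal (fe e)]; first by rewrite mem_enum.
by apply/ffunP=> e; rewrite !ffunE /=; have := fB e; lia.
Qed.

Section Bounded.
Variable rank : V -> nat.
Hypothesis rank_lt : forall e, (rank (l e) < rank (r e))%N.

(** All edges lead to a higher rank, so that nothing flows back through the cut just
    above the rank of l e, and the flow through e is at most the total outflow on the
    lower side. *)
Lemma flow_bound (c : E -> int) b e :
  (forall e, 0 <= c e) -> (forall v, outflow c v = b v) ->
  c e <= \sum_v `|b v|.
Proof.
move=> c0 cb; pose S := [set v | (rank v <= rank (l e))%N].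
apply: (@le_trans _ _ (\sum_(v in S) b v)).
  rewrite -(eq_bigr _ (fun v _ => cb v)) outflow_cut (bigD1 e) //= !inE leqnn.
  rewrite leqNgt rank_lt subr0 mulr1 lerDl; apply: sumr_ge0 => e' _.
  apply: mulr_ge0 => //; rewrite !inE; have := rank_lt e'.
  by do 2!case: leqP => //=; lia.
apply: le_trans (ler_norm _) _; apply: le_trans (ler_norm_sum _ _ _) _.
by rewrite [leRHS](bigID (mem S)) /= lerDl sumr_ge0.
Qed.

Lemma flow_in_box B b f : (forall e, 0 <= f e) -> (forall v, outflow f v = b v) ->
  \sum_v `|b v| < B%:Z -> f \in box B.
Proof.
move=> f0 fb Bb; rewrite mem_box; apply/forallP=> e; rewrite f0 /=.
exact: le_lt_trans (flow_bound e f0 fb) Bb.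
Qed.

(** Let C be a circulation with coefficients 0, 1 and -1. The translation by C maps
    the flows that may vanish where C is 1 onto those that may vanish where C is -1.
    Both kinds of flows consist of the positive flows on D and of positive flows on D
    minus some edges of C. *)
Section Circulation.
Variables (C : E -> int) (D : {set E}).
Hypotheses (C1 : forall e, `|C e| <= 1) (CD : supported C D).
Hypothesis C0 : forall v, outflow C v = 0.

Definition weak_flow (s : int) b f :=
  [forall e, if e \in D then if C e == s then 0 <= f e else 0 < f e else f e == 0]
  && [forall v, outflow f v == b v].

Lemma weak_flow_ge0 s b f : weak_flow s b f ->
  (forall e, 0 <= f e) /\ (forall v, outflow f v = b v).
Proof.
case/andP=> /forallP f0 /forallP fb; split=> [e|v]; last exact/eqP.
by have := f0 e; case: ifP => _; [case: ifP => _; [|exact: ltW] | move/eqP->].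
Qed.

(** The set Z is the set of edges on which a weak flow vanishes. *)
Lemma weak_flow_sum s B b (w : (E -> int) -> rat) :
  \sum_(f <- box B | weak_flow s b f) w f
  = \sum_(Z : {set E} | Z \subset [set e in D | C e == s]) flow_sum B (D :\: Z) b w :> rat.
Proof.
pose zeros f := [set e in D | (C e == s) && (f e == 0)].
rewrite (partition_big zeros (fun Z => Z \subset [set e in D | C e == s])) /=; last first.
  by move=> f _; apply/subsetP=> e; rewrite !inE => /and3P[-> ->].
apply: eq_bigr => Z /subsetP sZ; apply: eq_bigl => f.
apply/andP/flowP => [[/andP[/forallP fD /forallP fb] /eqP eZ]|[fD f0 fb]].
  split=> [e|e|v]; last exact/eqP.
    rewrite -eZ !inE => /andP[] + De; have := fD e; rewrite De /=.
    by case: ifP => //= _; rewrite lt_def => -> ->.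
  by rewrite !inE negb_and negbK -eZ inE => /orP[/and3P[_ _ /eqP] //|];
    have := fD e; case: ifP => // _ /eqP.
split.
  apply/andP; split; apply/forallP; last by move=> v; rewrite fb.
  move=> e; case: ifP => De; last by rewrite f0 // inE De andbF.
  case: (boolP (e \in Z)) => [Ze|nZe].
    by have /[!inE]/andP[_ ->] := sZ e Ze; rewrite f0 // inE Ze.
  have fe : 0 < f e by apply: fD; rewrite inE nZe.
  by case: ifP => // _; apply: ltW.
apply/eqP/setP=> e; rewrite inE; case: (boolP (e \in Z)) => [Ze|nZe].
  by have /[!inE]/andP[-> ->] := sZ e Ze; rewrite f0 ?eqxx // inE Ze.
case: (boolP (e \in D)) => //= De.
have : 0 < f e by apply: fD; rewrite inE nZe.
by case: eqP => //= _; case: eqP => // ->.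
Qed.

Definition shift_by f : {ffun E -> int} := [ffun e => f e + C e].

Lemma weak_flow_shift b f : weak_flow 1 b f = weak_flow (-1) b (shift_by f).
Proof.
congr (_ && _).
  apply: eq_forallb => e; rewrite ffunE; case: (boolP (e \in D)) => [De|/CD->]; last by rewrite addr0.
  have := C1 e; case: (eqVneq (C e) 1) => [->|n1] /=; first lia.
  by case: (eqVneq (C e) (-1)) => [->|n2]; lia.
apply: eq_forallb => v; congr (_ == _).
rewrite -[LHS]addr0 -(C0 v) -outflowD; apply: eq_outflow => e.
by rewrite ffunE.
Qed.

Lemma weak_flow_sum_shift B b (G : (E -> int) -> rat) :
  \sum_v `|b v| < B%:Z ->
  \sum_(f <- box B | weak_flow 1 b f) G (shift_by f)
  = \sum_(f <- box B | weak_flow (-1) b f) G f.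
Proof.
move=> bB; rewrite -(big_filter _ (weak_flow (-1) b)) -(big_filter _ (weak_flow 1 b)).
rewrite -[LHS](big_map shift_by xpredT (fun f : {ffun E -> int} => G f)).
apply: perm_big.
have inj_shift : injective shift_by.
  by move=> f f' /ffunP ef; apply/ffunP=> e; have := ef e; rewrite !ffunE => /addIr.
apply: uniq_perm; rewrite ?map_inj_uniq ?filter_uniq ?box_uniq // => f.
rewrite mem_filter; apply/mapP/andP => [[f' + ->]|[wf fB]].
  rewrite mem_filter weak_flow_shift => /andP[wf _]; split=> //.
  by have [f0 fb] := weak_flow_ge0 wf; apply: flow_in_box bB.
pose f' : {ffun E -> int} := [ffun e => f e - C e].
have ef : shift_by f' = f by apply/ffunP=> e; rewrite !ffunE subrK.
exists f' => //; rewrite mem_filter weak_flow_shift ef wf /=.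
have wf' : weak_flow 1 b f' by rewrite weak_flow_shift ef.
by have [f0 fb] := weak_flow_ge0 wf'; apply: flow_in_box bB.
Qed.

Lemma flow_sum_telescope B b (w G : (E -> int) -> rat) :
  \sum_v `|b v| < B%:Z ->
  (forall f g : E -> int, f =1 g -> G f = G g) ->
  (forall f : E -> int, G (fun e => f e + C e) - G f = w f) ->
  flow_sum B D b w
  = \sum_(Z : {set E} | (Z \subset [set e in D | C e == -1]) && (Z != set0))
       flow_sum B (D :\: Z) b G
  - \sum_(Z : {set E} | (Z \subset [set e in D | C e == 1]) && (Z != set0))
       flow_sum B (D :\: Z) b (fun f : E -> int => G (fun e => f e + C e)).
Proof.
move=> bB extG dG.
(* the terms with Z = set0 of the two sums are those that make up the left-hand side *)
have eqS : \sum_(f <- box B | weak_flow 1 b f) G (fun e => f e + C e)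
    = \sum_(f <- box B | weak_flow (-1) b f) G f.
  rewrite -weak_flow_sum_shift //; apply: eq_bigr => f _.
  by apply: extG => e; rewrite ffunE.
rewrite (weak_flow_sum _ _ _ (fun f : E -> int => G (fun e => f e + C e))) weak_flow_sum in eqS.
rewrite (bigD1 set0) ?sub0set //= [in RHS](bigD1 set0) ?sub0set //= !setD0 in eqS.
have -> : flow_sum B D b w
    = flow_sum B D b (fun f : E -> int => G (fun e => f e + C e)) - flow_sum B D b G.
  by rewrite /flow_sum -sumrB; apply: eq_bigr => f _; rewrite dG.
by apply/eqP; rewrite subr_eq addrAC -subr_eq opprK; apply/eqP; rewrite eqS addrC.
Qed.
End Circulation.
End Bounded.
End FlowSum.

(** * Piecewise polynomiality of flow sums *)

Lemma polyfun_eq I d (p : (I -> int) -> rat) f g :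
  polyfun d p -> f =1 g -> p f = p g.
Proof.
move=> pp efg; elim: pp => {d p} //.
- by move=> d i; rewrite efg.
- by move=> d p q _ -> _ ->.
- by move=> d1 d2 p q _ -> _ ->.
- by move=> d p q epq _ IHp; rewrite -!epq.
Qed.

(** The outflow beta depends on parameters x that range over a set Reg, and on Reg the
    sum of beta over one side of a fundamental cut of a spanning tree has a constant
    sign. *)
Section FlowPolynomial.
Variables (V E : finType) (l r : E -> V) (rank : V -> nat) (o : V).
Hypothesis rank_lt : forall e, (rank (l e) < rank (r e))%N.
Hypothesis connE : spanning l r setT.
Variables (I : Type) (Reg : (I -> int) -> Prop) (beta : (I -> int) -> V -> int).
Variable y : I -> int.
Hypothesis Reg_y : Reg y.
Hypothesis beta_poly : forall v, polyfun 1 (fun x => (beta x v)%:~R).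
Hypothesis beta_total : forall x, Reg x -> \sum_v beta x v = 0.
Hypothesis beta_sign : forall (T : {set E}) e x,
  acyclic l r T -> spanning l r T -> e \in T -> Reg x ->
  Num.sg (\sum_(v in cut_side l r T e) beta x v)
  = Num.sg (\sum_(v in cut_side l r T e) beta y v).

Local Notation outflow := (outflow l r).
Local Notation acyclic := (acyclic l r).
Local Notation spanning := (spanning l r).
Local Notation flow_sum := (flow_sum l r).

(** There is at most one flow on an acyclic set. Its values are affine in x, and each
    of them is the sum of beta over one side of a fundamental cut, so that whether the
    flow is positive is the same for all x in Reg. *)
Lemma acyclic_flow_sum (D : {set E}) d (w : (E -> int) -> rat) :
  acyclic D -> polyfun d w ->
  exists2 phi, polyfun d phi & forall x B, Reg x ->
    \sum_v `|beta x v| < B%:Z -> flow_sum B D (beta x) w = phi x.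
Proof.
move=> aD pw; have [T [sDT aT spT]] := spanning_tree aD connE.
have [c Hc] := fin_all_exists (fun v => unit_flow (spT v o)).
pose F x e := \sum_v beta x v * c v e.
have FT x : supported (F x) T.
  by move=> e nT; rewrite /F big1 // => v _; have [_ -> // _] := Hc v; rewrite mulr0.
have outF x w' : Reg x -> outflow (F x) w' = beta x w'.
  move=> Rx; rewrite /F outflow_sum.
  have cout v : outflow (c v) w' = (w' == v)%:Z - (w' == o)%:Z by case: (Hc v).
  under eq_bigr do rewrite outflowZ cout mulrBr; rewrite sumrB -[X in _ - X]big_distrl /= beta_total //.
  rewrite mul0r subr0 (bigD1 w') //= eqxx mulr1 big1 ?addr0 // => v /negPf nv.
  by rewrite eq_sym nv mulr0.
have FP e : polyfun 1 (fun x => (F x e)%:~R).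
  apply: (@polyfun_ext _ _ (fun x => \sum_v (c v e)%:~R * (beta x v)%:~R)) => [x|].
    by rewrite /F rmorph_sum; apply: eq_bigr => v _; rewrite rmorphM mulrC.
  by apply: polyfun_sum => v _; apply: polyfun_scale.
(* whether the only candidate is positive on D and vanishes elsewhere *)
pose pos x := [forall e, if e \in D then 0 < F x e else F x e == 0].
have pos_y x : Reg x -> pos x = pos y.
  move=> Rx; apply: eq_forallb => e.
  case: (boolP (e \in T)) => [Te|nT]; last first.
    have /negPf-> : e \notin D by apply: contra nT; exact: (subsetP sDT e).
    by rewrite !FT.
  have Fe z : Reg z -> F z e = \sum_(v in cut_side l r T e) beta z v.
    by move=> Rz; rewrite (tree_flow aT (FT z) Te); apply: eq_bigr => v _; rewrite outF.
  by rewrite -[0 < F x e]sgr_gt0 -[F x e == 0]sgr_eq0 Fe // beta_sign // -Fe // sgr_gt0 sgr_eq0.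
have flowE x (f : {ffun E -> int}) : Reg x ->
    flow l r D (beta x) f = pos y && (f == [ffun e => F x e]).
  move=> Rx; apply/flowP/andP => [[fD f0 fb]|[]].
    have fF e : f e = F x e.
      apply/eqP; rewrite -subr_eq0; apply/eqP; move: e.
      apply: (aT (fun e => f e - F x e)) => [v|e nT].
        by rewrite outflowB fb outF // subrr.
      by rewrite FT // f0 ?subrr //; apply: contra nT; exact: (subsetP sDT e).
    split; last by apply/eqP/ffunP=> e; rewrite ffunE.
    rewrite -(pos_y x Rx); apply/forallP=> e; rewrite -fF.
    by case: ifP => [|/negbT] De; [exact: fD | rewrite f0].
  rewrite -(pos_y x Rx) => /forallP posx /eqP->; split=> [e De|e De|v].
  - by have := posx e; rewrite De ffunE.
  - by have := posx e; rewrite (negPf De) ffunE => /eqP.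
  - by rewrite -(outF x v Rx); apply: eq_outflow => e; rewrite ffunE.
exists (fun x => if pos y then w (F x) else 0).
  by case: (pos y); [apply: polyfun_comp | apply: polyfun_const].
move=> x B Rx xB; rewrite /flow_sum; under eq_bigl => f do rewrite flowE //.
case: (boolP (pos y)) => [py|_]; last by rewrite big_pred0_eq.
have FB : [ffun e => F x e] \in box E B.
  have /flowP[F0 Fn Fb] : flow l r D (beta x) [ffun e => F x e] by rewrite flowE ?py ?eqxx.
  apply: (flow_in_box rank_lt _ Fb) => // e.
  by case: (boolP (e \in D)) => [/F0/ltW|/Fn->].
rewrite -big_filter (@eq_filter _ _ (pred1 [ffun e => F x e])) // filter_pred1_uniq ?box_uniq //.
by rewrite big_seq1; apply: polyfun_eq pw _ => e; rewrite ffunE.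
Qed.

(** The set X meets all cycles in D. An edge x0 of X either closes no cycle with D
    minus X, and then X may be replaced by X minus x0, or it closes a cycle C. In the
    second case the sum telescopes along C; once any edge of C is removed from D, the
    set X minus x0 meets all remaining cycles. Each edge of X raises the degree by at
    most 1. *)
Theorem flow_sum_polyfun (D X : {set E}) d (w : (E -> int) -> rat) :
  acyclic (D :\: X) -> polyfun d w ->
  exists2 phi, polyfun (d + #|X|) phi & forall x B, Reg x ->
    \sum_v `|beta x v| < B%:Z -> flow_sum B D (beta x) w = phi x.
Proof.
have [m] := ubnP #|X|; elim: m => // m IHm in D X d w * => leX aDX pw.
have [X0|[x0 Xx0]] := set_0Vmem X.
  by rewrite X0 cards0 addn0; apply: acyclic_flow_sum => //; rewrite -[D]setD0 -X0.
have cX : (#|X| = #|X :\ x0|.+1)%N by rewrite (cardsD1 x0) Xx0.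
have leX' : (#|X :\ x0| < m)%N by rewrite cX in leX.
pose F := D :\: X.
have nFx0 : x0 \notin F by rewrite !inE Xx0.
case: (boolP (connect (joined l r F) (l x0) (r x0) && (x0 \in D)))
  => [/andP[cn Dx0]|ncn]; last first.
  have aF : acyclic (D :\: (X :\ x0)).
    case: (boolP (x0 \in D)) => Dx0.
      have ncn' : ~~ connect (joined l r F) (l x0) (r x0) by rewrite Dx0 andbT in ncn.
      apply: acyclicS (acyclicU1 aDX ncn').
      by apply/subsetP=> e; rewrite !inE; case: (e == x0); case: (e \in X).
    apply: acyclicS aDX; apply/subsetP=> e; rewrite !inE.
    by case: eqVneq => [->|] //=; rewrite (negPf Dx0) andbF.
  have [phi pphi ephi] := IHm D _ d w leX' aF pw.
  by exists phi => //; apply: polyfunW pphi; rewrite leq_add2l cX.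
rewrite joined_connect_sym in cn.
have [c [c1 cF co]] := unit_flow cn.
pose C e := (e == x0)%:Z + c e.
have Cx0 : C x0 = 1 by rewrite /C eqxx cF.
have C1 e : `|C e| <= 1.
  by rewrite /C; case: eqVneq => [->|_]; [rewrite cF | rewrite add0r].
have CD : supported C D.
  move=> e nD; rewrite /C cF ?addr0; last by rewrite !inE negb_and nD orbT.
  by case: eqVneq => // ex0; rewrite ex0 Dx0 in nD.
have C0 v : outflow C v = 0 by rewrite outflowD outflow_delta co; ring.
have [G pG dG] := polyfun_antidifference Cx0 pw.
have extG f g : f =1 g -> G f = G g by move=> efg; apply: polyfun_eq pG efg.
have pG' : polyfun d.+1 (fun f => G (fun e => f e + C e)).
  apply: polyfun_comp pG _ => e; apply: (@polyfun_ext _ _ (fun f => (f e)%:~R + (C e)%:~R)).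
    by move=> f; rewrite intrD.
  by apply: polyfun_add; [apply: polyfun_var | apply: polyfun_const].
(* a circulation that avoids an edge z of C also avoids x0: otherwise a multiple of C
   could be subtracted from it to obtain a circulation on the acyclic set F *)
have aZ (s : int) (Z : {set E}) : s != 0 -> (Z \subset [set e in D | C e == s]) && (Z != set0) ->
    acyclic ((D :\: Z) :\: (X :\ x0)).
  move=> s0 /andP[/subsetP sZ /set0Pn[z Zz]] k k0 kD.
  have /[!inE]/andP[_ /eqP Cz] := sZ z Zz.
  have kC e : k e - k x0 * C e = 0.
    move: e; apply: (aDX (fun e => k e - k x0 * C e)) => [v|e].
      by rewrite outflowB outflowZ k0 C0 mulr0 subrr.
    rewrite -/F => nF; case: (eqVneq e x0) => [->|ne]; first by rewrite Cx0 mulr1 subrr.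
    rewrite /C (negPf ne) cF // addr0 mulr0 subr0; apply: kD.
    by apply: contra nF; rewrite !inE ne /= => /and3P[-> _ ->].
  have kx0 : k x0 = 0.
    have := kC z; rewrite Cz kD ?inE ?Zz ?andbF // sub0r => /eqP.
    by rewrite oppr_eq0 mulf_eq0 (negPf s0) orbF => /eqP.
  by move=> e; have := kC e; rewrite kx0 mul0r subr0.
have sumP (s : int) K : s != 0 -> polyfun d.+1 K -> exists2 phi, polyfun (d + #|X|) phi &
    forall x B, Reg x -> \sum_v `|beta x v| < B%:Z ->
    \sum_(Z : {set E} | (Z \subset [set e in D | C e == s]) && (Z != set0))
       flow_sum B (D :\: Z) (beta x) K = phi x.
  move=> s0 pK.
  have step (Z : {set E}) : exists phi : (I -> int) -> rat,
      (Z \subset [set e in D | C e == s]) && (Z != set0) ->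
      polyfun (d + #|X|) phi /\ forall x B, Reg x ->
        \sum_v `|beta x v| < B%:Z -> flow_sum B (D :\: Z) (beta x) K = phi x.
    case: (boolP ((Z \subset [set e in D | C e == s]) && (Z != set0)))
      => [ZP|_]; last by exists (fun=> 0).
    have [phi pphi ephi] := IHm (D :\: Z) _ d.+1 K leX' (aZ s Z s0 ZP) pK.
    by exists phi => _; split=> //; rewrite cX addnS -addSn.
  have [phi Hphi] := fin_all_exists step.
  exists (fun x => \sum_(Z : {set E} | (Z \subset [set e in D | C e == s]) && (Z != set0)) phi Z x).
    by apply: polyfun_sum => Z /Hphi[].
  by move=> x B Rx xB; apply: eq_bigr => Z /Hphi[_ ->].
have [phi1 p1 e1] := sumP (-1) _ isT pG.
have [phi2 p2 e2] := sumP 1 _ isT pG'.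
exists (fun x => phi1 x - phi2 x).
  by apply: polyfun_add => //; apply: polyfun_opp.
move=> x B Rx xB; rewrite (flow_sum_telescope rank_lt C1 CD C0 xB extG dG).
by rewrite e1 // e2.
Qed.
End FlowPolynomial.

(** * Leaky covers as flows on admissible graphs *)

Section Covers.
Variables (R : realFieldType) (n r : nat).
Implicit Types (c : graph_cover R n r) (x : 'I_n -> int) (P : {set 'I_n}).
Implicit Types (t : 'I_r -> R).

(** Minus the Euler characteristic of the vertex v with its flags as punctures. *)
Definition euler c (v : vert c) : int := 2 * (gen c v)%:Z - 2 + (valence v)%:Z.

(** The value that the leaky condition at v prescribes for the outflow of the
    expansion factors. *)
Definition excess c (k : int) x (v : vert c) : int :=
  \sum_(i | endv c i == v) x i - k * euler v.

(** The part of the definition of a leaky cover that mentions neither lengths nor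
    expansion factors; P is the set of the ends of positive degree. As no vertex of
    the line lies below the interior of an edge, an edge leads from one position to
    the next. *)
Definition admissible (g : nat) P c : bool :=
  [&& [forall u, forall v, connect (@adjacent R n r c) u v],
      g == (betti c + \sum_v gen c v)%N,
      [forall e, pos c (rgt c e) == (pos c (lft c e)).+1 :> nat],
      [forall i, pos c (endv c i) == (if i \in P then 0 else r.-1)%N :> nat],
      [forall v : vert c, ~~ ((gen c v == 0%N) && (valence v == 1%N))],
      [forall j, exists v : vert c,
         (pos c v == j) && ((0 < gen c v)%N || (2 < valence v)%N)],
      P != set0 & P != setT].

Lemma leaky_excess c k x (v : vert c) :
  ((left_degree x v)%:Z - (right_degree x v)%:Z = k * euler v)
  <-> outflow (lft c) (rgt c) (fun e => (exf c e)%:Z) v = excess k x v.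
Proof.
have PoszS := big_morph Posz PoszD (erefl _).
have ends : \sum_(i | (endv c i == v) && (0 < x i)) `|x i|%N%:Z
    - \sum_(i | (endv c i == v) && (x i < 0)) `|x i|%N%:Z
    = \sum_(i | endv c i == v) x i.
  rewrite !big_mkcondr -sumrB; apply: eq_bigr => i _.
  by case: (ltrgtP 0 (x i)) => [||<-]; lia.
rewrite /left_degree /right_degree /excess /outflow !PoszD !PoszS -ends.
have rearrange (a b p q w : int) : a + p - (b + q) = w <-> b - a = p - q - w by lia.
exact: rearrange.
Qed.

Lemma line_graph_lt t i j : line_graph t -> (t i < t j) = (i < j)%N.
Proof.
move=> tP; case: (ltngtP i j) => [/tP // |/tP ji|/val_inj->]; last exact: ltxx.
by apply/negbTE; rewrite -leNgt ltW.
Qed.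

Lemma adjacent_joined c : connect (@adjacent R n r c) =2 connect (joined (lft c) (rgt c) setT).
Proof. by apply: eq_connect => u v; apply: eq_existsb => e; rewrite inE. Qed.

Lemma leaky_admissible g k P x t c : (0 < r)%N -> line_graph t ->
  in_domain g k P x -> is_leaky_cover g k x t c ->
  [/\ admissible g P c, forall e, (0 < exf c e)%N &
      forall v, outflow (lft c) (rgt c) (fun e => (exf c e)%:Z) v = excess k x v].
Proof.
move=> r_gt0 tP [_ xP] [conn gE len0 exf0 aff inner lend rend surj leaky stab spec].
have posP e : pos c (rgt c e) = (pos c (lft c e)).+1 :> nat.
  have lt_e : (pos c (lft c e) < pos c (rgt c e))%N.
    rewrite -(line_graph_lt _ _ tP) -subr_gt0 -aff.
    by apply: mulr_gt0; rewrite ?ltr0n.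
  apply/eqP; rewrite eqn_leq lt_e andbT leqNgt; apply/negP => lt2.
  have lt_r : ((pos c (lft c e)).+1 < r)%N by apply: ltn_trans lt2 (ltn_ord _).
  by apply: (inner e (Ordinal lt_r)); rewrite !(line_graph_lt _ _ tP) /= ltnSn.
have r1 : (r.-1 < r)%N by rewrite prednK.
split=> //; last by move=> v; apply/leaky_excess/leaky.
apply/and5P; split; last (apply/and4P; split).
- by apply/forallP=> u; apply/forallP=> v; apply: conn.
- exact/eqP.
- by apply/forallP=> e; apply/eqP.
- apply/forallP=> i; have := xP i; case: ifP => Pi xi.
    rewrite -leqn0 leqNgt; apply/negP=> lt0.
    by apply: (lend i (Ordinal r_gt0) xi); rewrite (line_graph_lt _ _ tP).
  rewrite eqn_leq -ltnS prednK // ltn_ord /= leqNgt; apply/negP=> lt0.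
  by apply: (rend i (Ordinal r1) xi); rewrite (line_graph_lt _ _ tP).
- by apply/forallP=> v; apply/negP=> /andP[/eqP g0 /eqP v1]; apply: (stab v).
- by apply/forallP=> j; have [v <- vs] := spec j; apply/existsP; exists v; rewrite eqxx.
- apply/eqP=> P0; have [[v tv]|[e /andP[te _]]|[i xi]|[i xi]] := surj (t (Ordinal r_gt0) - 1).
  + have : t (pos c v) < t (Ordinal r_gt0) by rewrite -tv ltrBlDr ltrDl.
    by rewrite (line_graph_lt _ _ tP).
  + have : t (pos c (lft c e)) < t (Ordinal r_gt0) by apply: lt_trans te _; rewrite ltrBlDr ltrDl.
    by rewrite (line_graph_lt _ _ tP).
  + by have := xP i; rewrite P0 inE => /(lt_trans xi); rewrite ltxx.
  + move=> tx; have : t (pos c (endv c i)) < t (Ordinal r_gt0).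
      by apply: lt_trans tx _; rewrite ltrBlDr ltrDl.
    by rewrite (line_graph_lt _ _ tP).
- have no_gt (j : 'I_r) : t (Ordinal r1) < t j -> False.
    by rewrite (line_graph_lt _ _ tP) /= ltnNge -ltnS prednK ?ltn_ord.
  apply/eqP=> P0; have [[v tv]|[e /andP[_ te]]|[i xi]|[i xi]] := surj (t (Ordinal r1) + 1).
  + by apply: (no_gt (pos c v)); rewrite -tv ltrDl.
  + by apply: (no_gt (pos c (rgt c e))); apply: lt_trans te; rewrite ltrDl.
  + by move=> tx; apply: (no_gt (pos c (endv c i))); apply: lt_trans tx; rewrite ltrDl.
  + by have := xP i; rewrite P0 inE => /lt_trans/(_ xi); rewrite ltxx.
Qed.

Section Admissible.
Variables (g : nat) (P : {set 'I_n}) (c : graph_cover R n r).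
Hypothesis adm : admissible g P c.

Lemma adm_spanning : spanning (lft c) (rgt c) setT.
Proof.
case/and5P: adm => /forallP H _ _ _ _ u v.
by rewrite -adjacent_joined; apply: (forallP (H u)).
Qed.

Lemma adm_genus : g = (betti c + \sum_v gen c v)%N.
Proof. by case/and5P: adm => _ /eqP. Qed.

Lemma adm_pos e : pos c (rgt c e) = (pos c (lft c e)).+1 :> nat.
Proof. by case/and5P: adm => _ _ /forallP H _ _; apply/eqP. Qed.

Lemma adm_end i : pos c (endv c i) = (if i \in P then 0 else r.-1)%N :> nat.
Proof. by case/and5P: adm => _ _ _ /forallP H _; apply/eqP. Qed.

Lemma adm_stable (v : vert c) : ~~ ((gen c v == 0%N) && (valence v == 1%N)).
Proof. by case/and5P: adm => _ _ _ _ /and4P[/forallP H _ _ _]. Qed.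

Lemma adm_special j : exists2 v : vert c, pos c v = j & (0 < gen c v)%N || (2 < valence v)%N.
Proof.
case/and5P: adm => _ _ _ _ /and4P[_ /forallP/(_ j)/existsP[v /andP[/eqP vj vs]] _ _].
by exists v.
Qed.

Lemma adm_proper : P != set0 /\ P != setT.
Proof. by case/and5P: adm => _ _ _ _ /and4P[]. Qed.

(** The map is surjective because the graph is connected: between two consecutive
    positions there must be an edge. *)
Lemma admissible_leaky k x t : (0 < r)%N -> line_graph t -> in_domain g k P x ->
  (forall e, (0 < exf c e)%N) ->
  (forall v, outflow (lft c) (rgt c) (fun e => (exf c e)%:Z) v = excess k x v) ->
  (forall e, len c e = (t (pos c (rgt c e)) - t (pos c (lft c e))) / (exf c e)%:R) ->
  is_leaky_cover g k x t c.
Proof.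
move=> r_gt0 tP [_ xP] exf0 out lenE.
have ltt i j := line_graph_lt i j tP.
have exfN0 e : (exf c e)%:R != 0 :> R by rewrite pnatr_eq0 -lt0n.
have signP i : (0 < x i) = (i \in P).
  by have := xP i; case: ifP => // _ /ltW; rewrite leNgt => /negbTE.
have signN i : x i < 0 -> i \notin P.
  by move=> xi; rewrite -signP -leNgt ltW.
split.
- by move=> u v; rewrite adjacent_joined; apply: adm_spanning.
- exact: adm_genus.
- by move=> e; rewrite lenE divr_gt0 ?ltr0n // subr_gt0 ltt adm_pos.
- by [].
- by move=> e; rewrite lenE mulrCA mulfV ?mulr1.
- by move=> e j; rewrite !ltt adm_pos ltnS ltnNge => /andP[/negP].
- by move=> i j; rewrite signP ltt adm_end => ->.
- move=> i j /signN/negPf Pi; rewrite ltt adm_end Pi -ltnS prednK // ltnNge.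
  by move/negP; apply; exact: ltn_ord.
- move=> y.
  have r1 : (r.-1 < r)%N by rewrite prednK.
  case: (ltP y (t (Ordinal r_gt0))) => [y0|y0].
    have [/set0Pn[i Pi] _] := adm_proper.
    constructor 3; exists i; rewrite ?signP // (_ : pos c _ = Ordinal r_gt0) //.
    by apply/val_inj; rewrite /= adm_end Pi.
  case: (ltP (t (Ordinal r1)) y) => [y1|y1].
    have [_ nT] := adm_proper; have [i Pi] : exists i, i \notin P.
      apply/existsP; apply: contraNT nT => /existsPn nP; apply/eqP/setP=> i.
      by rewrite inE; apply/negPn/nP.
    constructor 4; exists i; first by have := xP i; rewrite (negPf Pi).
    rewrite (_ : pos c _ = Ordinal r1) //.
    by apply/val_inj; rewrite /= adm_end (negPf Pi).
  case: (@arg_maxnP _ (Ordinal r_gt0) (fun j => t j <= y) (@nat_of_ord r) y0) => j ty maxj.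
  have [yt|yt] := eqVneq y (t j).
    by have [v vj _] := adm_special j; constructor 1; exists v; rewrite vj.
  have {ty yt} ty : t j < y by rewrite lt_neqAle eq_sym yt.
  have jr : (j.+1 < r)%N.
    rewrite ltn_neqAle ltn_ord andbT; apply/eqP=> jr.
    have jE : j = Ordinal r1 by apply/val_inj => /=; rewrite -[LHS]/(j.+1.-1) jr.
    by move: ty; rewrite jE ltNge y1.
  have ty' : y < t (Ordinal jr).
    by rewrite ltNge; apply/negP=> /maxj /=; rewrite ltnn.
  constructor 2; pose S := [set v | (pos c v <= j)%N].
  have [e /andP[le_e lt_e]] : exists e, (pos c (lft c e) <= j < pos c (rgt c e))%N.
    apply/existsP; apply: contraT => /existsPn noe.
    have [u uj _] := adm_special j; have [v vj _] := adm_special (Ordinal jr).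
    have := @closed_connect _ _ (lft c) (rgt c) setT S u v _ (adm_spanning u v).
    rewrite !inE uj vj /= leqnn ltnn => cl; suff : true = false by [].
    by apply: cl => e _; have := noe e; rewrite !inE adm_pos; case: ltngtP => //; lia.
  exists e; have -> : pos c (lft c e) = j.
    by apply/val_inj/eqP; rewrite /= eqn_leq le_e /= -ltnS -adm_pos.
  rewrite ty (_ : pos c (rgt c e) = Ordinal jr) //.
  by apply/val_inj/eqP; rewrite /= eqn_leq lt_e adm_pos ltnS le_e.
- by move=> v; apply/leaky_excess.
- by move=> v [/eqP g0 /eqP v1]; have := adm_stable v; rewrite g0 v1.
- exact: adm_special.
Qed.
End Admissible.
End Covers.

(** * Euler characteristics of admissible graphs *)

Lemma fiber_card (T W : finType) (s : T -> W) (S : {set W}) :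
  (\sum_(v in S) #|[set e | s e == v]| = #|[set e | s e \in S]|)%N.
Proof.
rewrite -sum1_card (partition_big s (mem S)) /=; last by move=> e; rewrite inE.
apply: eq_bigr => v Sv; rewrite -sum1_card; apply: eq_bigl => e; rewrite !inE.
by case: eqVneq => [->|_]; rewrite ?andbT ?andbF.
Qed.

Section AdmissibleCounts.
Variables (R : realFieldType) (n r : nat).
Variable c : graph_cover R n r.
Implicit Types (v u : vert c) (e : edge c) (S : {set vert c}).

Lemma euler_cut S : \sum_(v in S) euler v =
  2 * (\sum_(v in S) gen c v)%N%:Z - 2 * #|S|%:Z
  + (#|[set e | lft c e \in S]| + #|[set e | rgt c e \in S]| + #|[set i | endv c i \in S]|)%N%:Z.
Proof.
have PoszS := big_morph Posz PoszD (erefl _).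
rewrite -!fiber_card -!big_split /= -sum1_card !PoszS !big_distrr /= -sumrB -big_split /=.
by apply: eq_bigr.
Qed.

(** A connected set S of vertices has at least #|S| - 1 inner edges, each of which
    accounts for two flags, and at least one edge that leaves S. *)
Lemma euler_connected S (o : vert c) (D : {set edge c}) e0 : o \in S ->
  (forall e, e \in D -> (lft c e \in S) = (rgt c e \in S)) ->
  (forall v, v \in S -> connect (joined (lft c) (rgt c) D) o v) ->
  (lft c e0 \in S) != (rgt c e0 \in S) ->
  #|[set i | endv c i \in S]|%:Z - 1 <= \sum_(v in S) euler v.
Proof.
move=> So DS connS cross.
pose F := [set e | (lft c e \in S) && (rgt c e \in S)].
have : (#|vert c| <= #|F| + #|o |: ~: S|)%N.
  apply: card_vertices_le (lft c) (rgt c) _ _ _ => U UF dU.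
  have nUo : o \notin U by apply/negP=> /(disjointFr dU); rewrite !inE eqxx.
  have US v : v \in U -> v \in S.
    by move=> Uv; have := disjointFr dU Uv; rewrite !inE => /norP[_ /negPn].
  apply/setP=> v; rewrite [RHS]inE; apply/negP=> Uv; move/negP: nUo; apply.
  rewrite (closed_connect (S := U) _ (connS v (US v Uv))) // => e De.
  case: (boolP (lft c e \in S)) => lS; first by apply: UF; rewrite inE lS -(DS e De).
  rewrite (contraNF (US _) lS); apply/esym/negbTE.
  by apply: contra lS => /US; rewrite (DS e De).
have -> : #|o |: ~: S| = #|~: S|.+1 by rewrite cardsU1 !inE So.
have : (#|F|.*2 < #|[set e | lft c e \in S]| + #|[set e | rgt c e \in S]|)%N.
  have sl : F \subset [set e | lft c e \in S] by apply/subsetP=> e; rewrite !inE => /andP[].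
  have sr : F \subset [set e | rgt c e \in S] by apply/subsetP=> e; rewrite !inE => /andP[].
  have nF : e0 \notin F by rewrite inE; case: (lft c e0 \in S) cross; case: (rgt c e0 \in S).
  rewrite -addnn; move: cross; case: (boolP (lft c e0 \in S)) => [l0 _|_ r0].
    rewrite -addSn leq_add ?subset_leq_card //; apply: proper_card.
    by apply/properP; split=> //; exists e0; rewrite // inE.
  rewrite -addnS leq_add ?subset_leq_card //; apply: proper_card.
  by apply/properP; split=> //; exists e0; rewrite // inE; case: (_ \in S) r0.
have := cardsC S; rewrite euler_cut.
set s := (\sum_(v in S) gen c v)%N.
lia.
Qed.

Variables (g : nat) (P : {set 'I_n}).
Hypotheses (n_gt0 : (0 < n)%N) (rE : (r + 2 = 2 * g + n)%N).
Hypothesis adm : admissible g P c.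

Lemma card_vert_tree : exists2 T : {set edge c},
  acyclic (lft c) (rgt c) T /\ spanning (lft c) (rgt c) T & #|vert c| = #|T|.+1.
Proof.
have [T [_ aT spT]] := spanning_tree (acyclic0 (l := lft c) (r := rgt c)) (adm_spanning adm).
by exists T => //; apply: (tree_card (endv c (Ordinal n_gt0)) aT spT).
Qed.

Lemma betti_card : (betti c + #|vert c| = #|edge c|.+1)%N.
Proof.
have [T _ vT] := card_vert_tree.
by rewrite /betti vT subSS addnS subnK ?max_card.
Qed.

Lemma euler_total : \sum_(v : vert c) euler v = r%:Z.
Proof.
have -> : \sum_(v : vert c) euler v = \sum_(v in [set: vert c]) euler v.
  by apply: eq_bigl => v; rewrite inE.
rewrite euler_cut.
have full (T : finType) (s : T -> vert c) : #|[set e | s e \in setT]| = #|T|.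
  by rewrite -[RHS]cardsT; apply: eq_card => e; rewrite !inE.
under eq_bigl do rewrite inE; rewrite !full cardsT card_ord.
have := betti_card; have := adm_genus adm; lia.
Qed.

Lemma euler_thin v : thin v -> euler v = 0.
Proof. by rewrite /thin /euler => /andP[/eqP-> /eqP->]. Qed.

Lemma valence_gt0 v : (0 < valence v)%N.
Proof.
rewrite lt0n; apply/negP=> /eqP v0.
have e0 : forall e, (lft c e == v) = false /\ (rgt c e == v) = false.
  move: v0; rewrite /valence => /eqP; rewrite !addn_eq0 !cards_eq0 => /andP[/andP[]].
  move=> /eqP/setP l0 /eqP/setP r0 _ e.
  by have := l0 e; have := r0 e; rewrite !inE.
have i0 : forall i, (endv c i == v) = false.
  move: v0; rewrite /valence => /eqP; rewrite !addn_eq0 !cards_eq0 => /andP[_].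
  by move=> /eqP/setP n0 i; have := n0 i; rewrite !inE.
have := closed_connect (l := lft c) (r := rgt c) (D := setT) (S := [set v]) _
  (adm_spanning adm v (endv c (Ordinal n_gt0))).
rewrite !inE eqxx i0 => cl; suff : true = false by [].
by apply: cl => e _; rewrite !inE; have [-> ->] := e0 e.
Qed.

(** The valence is positive because the graph is connected and has an end, so the
    vertices excluded by stability are the only ones with a negative contribution. *)
Lemma euler_gt0 v : ~~ thin v -> 1 <= euler v.
Proof.
have := adm_stable adm v; have := valence_gt0 v; rewrite /thin /euler.
by case: (gen c v) => [|m]; case: (valence v) => [|[|[|w]]] //=; lia.
Qed.

Lemma euler_ge0 v : 0 <= euler v.
Proof.
by case: (boolP (thin v)) => [/euler_thin->//|/euler_gt0]; apply: le_trans.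
Qed.

Lemma special_nthin j : exists2 v, pos c v = j & ~~ thin v.
Proof.
have [v vj vs] := adm_special adm j; exists v => //; move: vs; rewrite /thin.
by case: (gen c v) => //=; case: eqP => // ->.
Qed.

(** Each of the r positions contributes at least 1, and the total is r. *)
Lemma euler_fiber j : \sum_(v | pos c v == j) euler v = 1.
Proof.
pose F j := \sum_(v | pos c v == j) euler v.
have F1 i : 0 <= F i - 1.
  have [v vj nv] := special_nthin i.
  rewrite subr_ge0 /F (bigD1 v) ?vj //=; apply: le_trans (euler_gt0 nv) _.
  by rewrite lerDl sumr_ge0 // => u _; apply: euler_ge0.
have : \sum_i (F i - 1) = 0.
  have -> : \sum_i (F i - 1) = \sum_(v : vert c) euler v - \sum_(i < r) 1.
    by rewrite sumrB; congr (_ - _); rewrite [RHS](partition_big (pos c) xpredT).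
  rewrite euler_total.
  by rewrite sumr_const card_ord -mulr_natr mul1r natz subrr.
move/eqP; rewrite psumr_eq0 // => /allP/(_ j).
by rewrite mem_index_enum subr_eq0 => /(_ isT)/eqP.
Qed.

Lemma nthin_unique u v : ~~ thin u -> ~~ thin v -> pos c u = pos c v -> u = v.
Proof.
move=> nu nv uv; apply/eqP; apply: contraT => neq.
have := euler_fiber (pos c v).
rewrite (bigD1 v) //= (bigD1 u) ?uv ?eqxx ?neq //=.
have : 0 <= \sum_(i | (pos c i == pos c v) && (i != v) && (i != u)) euler i.
  by apply: sumr_ge0 => w _; apply: euler_ge0.
move: (euler_gt0 nu) (euler_gt0 nv); move: (euler u) (euler v) (\sum_(i | _) _) => a b s.
lia.
Qed.

Lemma euler_nthin v : ~~ thin v -> euler v = 1.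
Proof.
move=> nv; have := euler_fiber (pos c v); rewrite (bigD1 v) //= big1 ?addr0 // => u /andP[/eqP uv neq].
by apply: euler_thin; apply: contraNT neq => nu; apply/eqP/nthin_unique.
Qed.

Lemma card_nthin : #|[set v : vert c | ~~ thin v]| = r.
Proof.
rewrite -[RHS](card_ord r) -[RHS]cardsT.
have -> : [set: 'I_r] = pos c @: [set v : vert c | ~~ thin v].
  apply/esym/eqP; rewrite eqEsubset subsetT /=; apply/subsetP=> j _.
  by have [v <- nv] := special_nthin j; apply: imset_f; rewrite inE.
by rewrite card_in_imset // => u v; rewrite !inE; apply: nthin_unique.
Qed.

End AdmissibleCounts.

(** * Fundamental cuts and walls *)

Section Walls.
Variables (R : realFieldType) (n r g : nat) (P : {set 'I_n}).
Variable c : graph_cover R n r.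
Hypotheses (n_gt0 : (0 < n)%N) (rE : (r + 2 = 2 * g + n)%N).
Hypothesis adm : admissible g P c.
Implicit Types (v u : vert c) (e : edge c) (S : {set vert c}) (k : int).

Lemma excess_cut k x S : \sum_(v in S) excess k x v
  = \sum_(i in [set i | endv c i \in S]) x i - k * \sum_(v in S) euler v.
Proof.
rewrite /excess sumrB -big_distrr /=; congr (_ - _).
rewrite [RHS](partition_big (endv c) (mem S)) /=; last by move=> i; rewrite inE.
apply: eq_bigr => v Sv; apply: eq_bigl => i; rewrite inE.
by case: eqVneq => [->|_]; rewrite ?Sv ?andbF.
Qed.

Lemma excess_total k x : in_domain g k P x -> \sum_v excess (c := c) k x v = 0.
Proof.
move=> [xs _]; have -> : \sum_v excess (c := c) k x v = \sum_(v in [set: vert c]) excess k x v.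
  by apply: eq_bigl => v; rewrite inE.
rewrite excess_cut; have -> : \sum_(v in [set: vert c]) euler v = \sum_v euler (c := c) v.
  by apply: eq_bigl => v; rewrite inE.
rewrite (euler_total n_gt0 rE adm).
have -> : \sum_(i in [set i | endv c i \in setT]) x i = \sum_i x i.
  by apply: eq_bigl => i; rewrite !inE.
rewrite xs -mulrBr (_ : _ - _ = 0) ?mulr0 //; lia.
Qed.

(** Both sides of a fundamental cut are connected. The lower bound of
    [euler_connected] for the other side is an upper bound for this one. *)
Lemma euler_cut_side (T : {set edge c}) e S :
  acyclic (lft c) (rgt c) T -> spanning (lft c) (rgt c) T -> e \in T ->
  S = cut_side (lft c) (rgt c) T e ->
  1 <= \sum_(v in S) euler v + 2 - #|[set i | endv c i \in S]|%:Z <= 2 * g%:Z + 1.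
Proof.
move=> aT spT Te SE.
have nb := acyclic_bridge aT Te.
have DS e' : e' \in T :\ e -> (lft c e' \in S) = (rgt c e' \in S).
  by move=> De; rewrite SE !inE (same_connect_r (@joined_connect_sym _ _ _ _ _) (joined_edge _ _ De)).
have lS : lft c e \in S by rewrite SE inE connect0.
have rS : rgt c e \notin S by rewrite SE inE.
have cross : (lft c e \in S) != (rgt c e \in S) by rewrite lS (negPf rS).
have crossC : (lft c e \in ~: S) != (rgt c e \in ~: S) by rewrite !inE lS (negPf rS).
have connS v : v \in S -> connect (joined (lft c) (rgt c) (T :\ e)) (lft c e) v by rewrite SE inE.
have connC v : v \in ~: S -> connect (joined (lft c) (rgt c) (T :\ e)) (rgt c e) v.
  pose W := [set v | connect (joined (lft c) (rgt c) (T :\ e)) (rgt c e) v].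
  have SW u : u \in S :|: W.
    rewrite -(closed_connect (S := S :|: W) _ (spT (lft c e) u)) ?inE ?lS ?connect0 // => e' Te'.
    case: (eqVneq e' e) => [->|ne]; first by rewrite !inE lS connect0 orbT.
    have De : e' \in T :\ e by rewrite !inE ne.
    by rewrite !inE (DS e' De) (same_connect_r (@joined_connect_sym _ _ _ _ _) (joined_edge _ _ De)).
  by have := SW v; rewrite !inE => /orP[->|].
have lo := euler_connected lS DS connS cross.
have hi : #|[set i | endv c i \in ~: S]|%:Z - 1 <= \sum_(v in ~: S) euler v.
  apply: (euler_connected (o := rgt c e) (D := T :\ e) _ _ connC crossC); first by rewrite inE.
  by move=> e' De; rewrite !inE DS.
have tot : \sum_(v in S) euler v + \sum_(v in ~: S) euler v = r%:Z.
  rewrite -(euler_total n_gt0 rE adm) [RHS](bigID (mem S)) /=; congr (_ + _).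
  by apply: eq_bigl => v; rewrite inE.
have totI : (#|[set i | endv c i \in S]| + #|[set i | endv c i \in ~: S]| = n)%N.
  rewrite -[RHS]card_ord -(cardsC [set i | endv c i \in S]); congr (_ + _)%N.
  by apply: eq_card => i; rewrite !inE.
lia.
Qed.

(** If there are ends on both sides of the cut, the bounds on the Euler characteristic
    provide h and m such that the sum of the excesses is the form of the wall given by
    the ends on one side, h and m; here m is 1 or 2, according to parity. Otherwise
    the sum is constant on the domain. *)
Lemma excess_sign k x y (T : {set edge c}) e :
  acyclic (lft c) (rgt c) T -> spanning (lft c) (rgt c) T -> e \in T ->
  in_domain g k P x -> in_domain g k P y -> same_region g k y x ->
  Num.sg (\sum_(v in cut_side (lft c) (rgt c) T e) excess k x v)
  = Num.sg (\sum_(v in cut_side (lft c) (rgt c) T e) excess k y v).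
Proof.
move=> aT spT Te [xs _] [ys _] reg.
have := euler_cut_side aT spT Te (erefl _); set S := cut_side _ _ _ _.
rewrite !excess_cut; set I := [set i | _]; set s : int := \sum_(v in S) euler v => Nb.
case: (eqVneq I set0) => [->|I0]; first by rewrite !big_set0.
case: (eqVneq I setT) => [->|IT].
  have full z : \sum_(i in [set: 'I_n]) z i = \sum_i z i :> int.
    by apply: eq_bigl => i; rewrite inE.
  by rewrite !full xs ys.
have [h [m [m0 hm sE]]] : exists h m,
    [/\ (0 < m)%N, (h + m <= g.+1)%N & s = 2 * h%:Z - 2 + (#|I| + m)%:Z].
  (* h and m have to satisfy 2 * h + m = s + 2 - #|I| *)
  pose z : int := s + 2 - #|I|%:Z; pose N := absz z; exists (N.-1)./2, (if odd N then 1 else 2)%N.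
  have NE : N%:Z = s + 2 - #|I|%:Z by rewrite /N /z; lia.
  have := odd_double_half N; case: (odd N) => Nh; split=> //; lia.
have W : is_wall g I h m by rewrite /is_wall I0 IT m0.
by have := reg I h m W; rewrite /wall_form -sE.
Qed.
End Walls.

(** * Cycles, potentials and lattice indices *)

Section CycleSpace.
Variables (V E : finType) (l r : E -> V).

(** The edges of F form a rooted forest, in which each edge leads from a child to a
    parent of lower rank. The potential H may be prescribed at the roots, and it is
    extended in the order of increasing rank. *)
Lemma forest_extension (F : {set E}) (rk : V -> nat) (child : E -> V) :
  {in F &, injective child} ->
  (forall e, e \in F -> (child e == l e) && (rk (r e) < rk (l e))%N
                     || (child e == r e) && (rk (l e) < rk (r e))%N) ->
  forall (h : V -> int) (b : E -> int), exists H : V -> int,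
    (forall v, (forall e, e \in F -> child e != v) -> H v = h v) /\
    (forall e, e \in F -> H (r e) - H (l e) = b e).
Proof.
move=> inj_child rkP h b.
suff step m : exists H : V -> int,
    (forall v, (forall e, e \in F -> child e != v) -> H v = h v) /\
    (forall e, e \in F -> (rk (child e) < m)%N -> H (r e) - H (l e) = b e).
  have [H [Hh Hb]] := step (\max_v rk v).+1; exists H; split=> // e Fe.
  by apply: Hb => //; rewrite ltnS; apply: leq_bigmax.
elim: m => [|m [H [Hh Hb]]]; first by exists h.
pose val_at e : int := if child e == l e then H (r e) - b e else H (l e) + b e.
exists (fun v => if [pick e in F | (child e == v) && (rk v == m)] is Some e
                 then val_at e else H v); split=> [v nv|e Fe].
  by case: pickP => [e /and3P[Fe /eqP ev _]|_]; [have := nv e Fe; rewrite ev eqxx | apply: Hh].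
rewrite ltnS => le_m.
have low v : (rk v < m)%N ->
    (if [pick e in F | (child e == v) && (rk v == m)] is Some e then val_at e else H v) = H v.
  by case: pickP => [e' /and3P[_ _ /eqP->]|//]; rewrite ltnn.
have [lt_m|] := ltnP (rk (child e)) m.
  rewrite !low ?Hb //; move: lt_m.
    by case/orP: (rkP e Fe) => /andP[/eqP->] // /ltn_trans; apply.
  by case/orP: (rkP e Fe) => /andP[/eqP->] // /ltn_trans; apply.
move=> ge_m; have rm : rk (child e) = m by apply/eqP; rewrite eqn_leq le_m.
have at_child : (if [pick e' in F | (child e' == child e) && (rk (child e) == m)] is Some e'
    then val_at e' else H (child e)) = val_at e.
  case: pickP => [e' /and3P[Fe' /eqP ee' _]|/(_ e)]; last by rewrite Fe eqxx rm eqxx.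
  by rewrite (inj_child _ _ Fe' Fe ee').
case/orP: (rkP e Fe) => /andP[/eqP ce lt_rk].
  rewrite [X in X - _]low; last by rewrite -rm ce.
  by rewrite -ce at_child /val_at ce eqxx subKr.
rewrite [X in _ - X]low; last by rewrite -rm ce.
rewrite -ce at_child /val_at ifF; first by rewrite addrC addKr.
by apply/eqP=> cl; rewrite -cl ce ltnn in lt_rk.
Qed.

(** The cycle z i closes the i-th edge outside T through T, and d i is the indicator
    of that edge. A function orthogonal to all cycles is the difference of a
    potential: choose the potential to be right on T, and test with the cycles. *)
Lemma cycle_space (T : {set E}) b : acyclic l r T -> spanning l r T -> b = #|~: T| ->
  exists z d : 'I_b -> E -> int,
  [/\ forall i v, outflow l r (z i) v = 0,
      forall w, (forall v, outflow l r w v = 0) ->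
        exists! a : 'rV[int]_b, forall e, w e = \sum_i a 0 i * z i e,
      forall i j, \sum_e z i e * d j e = (i == j)%:Z &
      forall u, (forall i, \sum_e z i e * u e = 0) ->
        exists H : V -> int, forall e, u e = H (r e) - H (l e)].
Proof.
move=> aT spT bE.
pose e_ (i : 'I_b) : E := enum_val (cast_ord bE i).
have e_inj : injective e_ by move=> i j /enum_val_inj/cast_ord_inj.
have e_T i : e_ i \notin T by have := enum_valP (cast_ord bE i); rewrite inE.
have e_onto e : e \notin T -> exists i, e = e_ i.
  move=> nT; have nT' : e \in ~: T by rewrite inE.
  by exists (cast_ord (esym bE) (enum_rank_in nT' e)); rewrite /e_ cast_ordKV enum_rankK_in.
have [p Hp] := fin_all_exists (fun i => unit_flow (spT (r (e_ i)) (l (e_ i)))).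
pose z i e := (e == e_ i)%:Z + p i e.
have z_out i v : outflow l r (z i) v = 0.
  by rewrite outflowD outflow_delta; have [_ _ ->] := Hp i; ring.
have z_e i j : z i (e_ j) = (i == j)%:Z.
  by rewrite /z (inj_eq e_inj); have [_ -> //] := Hp i; rewrite addr0 eq_sym.
exists z, (fun j e => (e == e_ j)%:Z); split=> //.
- move=> w w0; exists (\row_i w (e_ i)); split=> [e|a aw].
    apply/eqP; rewrite -subr_eq0; apply/eqP; move: e.
    apply: (aT (fun e => w e - \sum_i (\row_i w (e_ i)) 0 i * z i e)) => [v|e nT].
      rewrite outflowB w0 outflow_sum big1 ?subrr // => i _.
      by rewrite outflowZ z_out mulr0.
    have [i ->] := e_onto e nT; rewrite (bigD1 i) //= big1 => [|j /negPf ji].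
      by rewrite mxE z_e eqxx mulr1 addr0 subrr.
    by rewrite z_e ji mulr0.
  apply/rowP=> i; rewrite mxE aw (bigD1 i) //= big1 => [|j /negPf ji].
    by rewrite z_e eqxx mulr1 addr0.
  by rewrite z_e ji mulr0.
- move=> i j; rewrite (bigD1 (e_ j)) //= big1 => [|e /negPf ne].
    by rewrite z_e eqxx mulr1 addr0.
  by rewrite ne mulr0.
- move=> u u0; have [H HT] := potential u aT; exists H => e.
  case: (boolP (e \in T)) => [/HT //|/e_onto[i ->]].
  pose u' e := u e - (H (r e) - H (l e)).
  have u'T e' : e' \in T -> u' e' = 0 by move=> /HT He; rewrite /u' He subrr.
  have : \sum_e' z i e' * u' e' = 0.
    rewrite (eq_bigr (fun e' => z i e' * u e' + z i e' * (H (l e') - H (r e')))); last first.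
      by move=> e' _; rewrite /u'; ring.
    rewrite big_split /= u0 -sum_by_parts add0r big1 // => v _.
    by rewrite -/(outflow l r (z i) v) z_out mulr0.
  rewrite (bigD1 (e_ i)) //= big1 => [|e' ne].
    by rewrite addr0 z_e eqxx mul1r => /eqP; rewrite subr_eq0 => /eqP.
  case: (boolP (e' \in T)) => [/u'T->|nT]; first by rewrite mulr0.
  have [j ej] := e_onto e' nT; rewrite ej z_e; case: eqVneq => [ij|_]; last by rewrite mul0r.
  by rewrite ej ij eqxx in ne.
Qed.
End CycleSpace.

(** Lattice points are compared through their cosets in a finite group. *)
Lemma subgroup_index_quotient (U : finZmodType) (X Y : {group U}) d
    (phi : 'rV[int]_d -> U) (H : 'rV[int]_d -> Prop) :
  {morph phi : v w / v - w} -> Y \subset X ->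
  (forall v, phi v \in X) -> (forall a, a \in X -> exists v, phi v - a \in Y) ->
  (forall v, H v <-> phi v \in Y) -> subgroup_index H #|X : Y|%g.
Proof.
move=> phiB sYX phiX onto HE.
have coset_ex (i : 'I_#|rcosets Y X|) :
    exists v, (Y :* phi v)%g = enum_val i.
  have /rcosetsP[a Xa ->] := enum_valP i; have [v va] := onto a Xa.
  by exists v; apply/rcoset_eqP; rewrite mem_rcoset.
have [a aP] := fin_all_exists coset_ex.
exists a => v.
have vX : (Y :* phi v)%g \in rcosets Y X by rewrite -rcosetE; apply: imset_f.
have mem_iff i : H (v - a i) <-> (Y :* phi v)%g = enum_val i.
  by rewrite HE phiB -aP; split=> [va|/rcoset_eqP]; [apply/rcoset_eqP|]; rewrite mem_rcoset.
exists (enum_rank_in vX ((Y :* phi v)%g)); split.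
  by apply/mem_iff; rewrite enum_rankK_in.
by move=> i /mem_iff vi; apply: enum_val_inj; rewrite enum_rankK_in.
Qed.

(** * Chains of thin vertices *)

Lemma intr_Zp_eq0 (m : nat) (a : int) : (1 < m)%N ->
  (a%:~R == 0 :> 'Z_m) = (m%:Z %| a)%Z.
Proof.
move=> m1; have nat_eq0 (b : nat) : (b%:R == 0 :> 'Z_m) = (m %| b)%N.
  by rewrite -val_eqE /= val_Zp_nat.
case: a => b; first by rewrite -pmulrn nat_eq0 dvdzE.
by rewrite NegzE mulrNz oppr_eq0 -pmulrn nat_eq0 dvdzE abszN.
Qed.

Section Chains.
Variables (R : realFieldType) (n r : nat) (c : graph_cover R n r).
Implicit Types (v u : vert c) (e f : edge c).
Hypothesis lft_inj : forall e f, thin (lft c e) -> lft c e = lft c f -> e = f.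
Hypothesis rgt_inj : forall e f, thin (rgt c e) -> rgt c e = rgt c f -> e = f.
Hypothesis pos_succ : forall e, pos c (rgt c e) = (pos c (lft c e)).+1 :> nat.

(** The chain through e leads to the right to a vertex that is not thin; otherwise it
    goes on into an end. *)
Definition open_right e := [exists f, connect (@continues R n r c) e f && ~~ thin (rgt c f)].

Lemma long_edgeE e : long_edge e = ~~ thin (lft c e) && open_right e.
Proof.
apply/existsP/andP => [[f /and3P[-> ef nf]]|[nl /existsP[f /andP[ef nf]]]].
  by split=> //; apply/existsP; exists f; rewrite ef.
by exists f; rewrite /bounded_chain nl ef.
Qed.

Lemma open_rightE e :
  open_right e = ~~ thin (rgt c e) || [exists e', (rgt c e == lft c e') && open_right e'].
Proof.
apply/existsP/orP => [[f /andP[/connectP[[|e' p] /= ep ->] nf]]|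
  [ne|/existsP[e' /andP[/eqP ee' /existsP[f /andP[ef nf]]]]]].
- by left.
- case/andP: ep => /andP[ee' _] ep; right; apply/existsP; exists e'; rewrite ee' /=.
  by apply/existsP; exists (last e' p); rewrite nf andbT; apply/connectP; exists p.
- by exists e; rewrite connect0.
- case: (boolP (thin (rgt c e))) => te; last by exists e; rewrite connect0.
  exists f; rewrite nf andbT; apply: connect_trans ef; apply: connect1.
  by rewrite /continues te ee' eqxx.
Qed.

(** The edges that are not long form a rooted forest whose roots include all vertices
    that are not thin. In a chain that stops on the right, children are on the left of
    their parents, as the leftmost segment is missing; in a chain that goes on into a
    right end, children are on the right. *)
Lemma nonlong_extension (h : vert c -> int) (b : edge c -> int) : exists H : vert c -> int,
  (forall v, ~~ thin v -> H v = h v) /\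
  (forall e, ~~ long_edge e -> H (rgt c e) - H (lft c e) = b e).
Proof.
pose up v := [exists e, (lft c e == v) && open_right e].
pose rk v := if ~~ thin v then 0%N else if up v then (r - pos c v)%N else (r.+1 + pos c v)%N.
pose child e := if open_right e then lft c e else rgt c e.
pose F := [set e : edge c | ~~ long_edge e].
have up_lft e : thin (lft c e) -> up (lft c e) = open_right e.
  move=> te; apply/existsP/idP => [[f /andP[/eqP fe rf]]|re]; last by exists e; rewrite eqxx.
  by rewrite (lft_inj te (esym fe)).
have up_rgt e : thin (rgt c e) -> up (rgt c e) = open_right e.
  move=> te; rewrite open_rightE te /=; apply: eq_existsb => f.
  by rewrite eq_sym.
have thin_child e : e \in F -> thin (child e).
  rewrite inE long_edgeE negb_and negbK /child; case: ifP => [_|/negbT]; first by rewrite orbF.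
  by rewrite open_rightE negb_or negbK => /andP[].
have [||H [Hh Hb]] := @forest_extension _ _ (lft c) (rgt c) F rk child _ _ h b.
- move=> e f Fe Ff; have := thin_child e Fe; have := thin_child f Ff.
  rewrite /child; case: ifP => re; case: ifP => rf tf te //.
  + exact: lft_inj.
  + by move=> ef; have := up_rgt e te; rewrite ef up_lft // re rf.
  + by move=> ef; have := up_lft e te; rewrite ef up_rgt // re rf.
  + exact: rgt_inj.
- move=> e Fe; have := thin_child e Fe; rewrite /child /rk.
  have := pos_succ e; have := ltn_ord (pos c (lft c e)); have := ltn_ord (pos c (rgt c e)).
  case: ifP => re lt1 lt2 pe te; rewrite te /= eqxx /=; apply/orP; [left|right].
    rewrite (up_lft e te) re; case: (boolP (thin (rgt c e))) => tr /=.
      by rewrite up_rgt // re; lia.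
    by rewrite subn_gt0.
  rewrite (up_rgt e te) re; case: (boolP (thin (lft c e))) => tl //=.
  by rewrite up_lft // re; lia.
exists H; split=> [v tv|e ne]; last by apply: Hb; rewrite inE.
by apply: Hh => e /thin_child; apply: contraTneq => ->.
Qed.

Lemma chain_const (H : vert c -> int) e f :
  (forall e, ~~ long_edge e -> H (rgt c e) = H (lft c e)) ->
  connect (@continues R n r c) e f -> H (rgt c f) = H (rgt c e).
Proof.
move=> Hnl /connectP[p ep ->]; elim: p e ep => //= e' p IHp e /andP[/andP[/eqP ee' te] /IHp->].
by rewrite Hnl ?ee' // long_edgeE -ee' te.
Qed.

Section Heights.
Variable spv : 'I_r -> vert c.
Hypothesis spvP : forall v, ~~ thin v -> spv (pos c v) = v.
Hypothesis spv_thin : forall j, ~~ thin (spv j) /\ pos c (spv j) = j.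

(** By linearity it suffices to extend the heights for which one of the distances is 1
    and the others are 0. *)
Lemma height_functions : exists psi : 'rV[int]_r.-1 -> vert c -> int,
  [/\ forall s s' v, psi (s - s') v = psi s v - psi s' v,
      forall a s v, psi (a *: s) v = a * psi s v,
      forall s e, ~~ long_edge e -> psi s (rgt c e) = psi s (lft c e) &
      forall s v, ~~ thin v -> psi s v = \sum_(j < r.-1) s 0 j * (j < pos c v)%N%:Z].
Proof.
have [psi Hpsi] := fin_all_exists (fun j : 'I_r.-1 =>
  nonlong_extension (fun v => (j < pos c v)%N%:Z) (fun=> 0)).
exists (fun s v => \sum_j s 0 j * psi j v); split=> [s s' v|a s v|s e ne|s v nv].
- by rewrite -sumrB; apply: eq_bigr => j _; rewrite !mxE mulrBl.
- by rewrite big_distrr /=; apply: eq_bigr => j _; rewrite mxE mulrA.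
- apply: eq_bigr => j _; congr (_ * _); apply/eqP; rewrite -subr_eq0; apply/eqP.
  by have [_ ->] := Hpsi j.
- by apply: eq_bigr => j _; have [-> ] := Hpsi j.
Qed.

(** The distances between consecutive special vertices telescope. *)
Lemma height_difference (s : 'rV[int]_r.-1) (G : vert c -> int) u v :
  (forall (u v : vert c) (j : 'I_r.-1), ~~ thin u -> ~~ thin v ->
     pos c u = j :> nat -> pos c v = j.+1 :> nat -> s 0 j = G v - G u) ->
  ~~ thin u -> ~~ thin v ->
  \sum_(j < r.-1) s 0 j * (j < pos c v)%N%:Z - \sum_(j < r.-1) s 0 j * (j < pos c u)%N%:Z
  = G v - G u.
Proof.
move=> sG nu nv; pose K (j : nat) := if insub j is Some o then G (spv o) else 0.
have KE w : ~~ thin w -> \sum_(j < r.-1) s 0 j * (j < pos c w)%N%:Z = G w - K 0%N.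
  move=> nw; have Kw : K (pos c w) = G w by rewrite /K valK spvP.
  rewrite -Kw -(telescope_sumr (n := 0) (m := pos c w)) //.
  have le_w : (pos c w <= r.-1)%N by rewrite -ltnS prednK ?ltn_ord // (leq_trans _ (ltn_ord (pos c w))).
  rewrite big_mkord (big_ord_widen r.-1 (fun j => K j.+1 - K j)) // [RHS]big_mkcond /=.
  apply: eq_bigr => j _; case: ltnP => jw; last by rewrite mulr0.
  have jr1 : (j.+1 < r)%N by apply: leq_ltn_trans jw (ltn_ord _).
  have jr : (j < r)%N by apply: ltnW.
  rewrite mulr1 /K !insubT.
  have [n1 p1] := spv_thin (Sub (nat_of_ord j) jr); have [n2 p2] := spv_thin (Sub j.+1 jr1).
  by apply: sG; rewrite ?p1 ?p2.
by rewrite !KE //; ring.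
Qed.
End Heights.
End Chains.

(** * Residue classes modulo the expansion factors *)

HB.saturate finfun_of.

Section Residues.
Variables (E : finType) (w : E -> nat).
Hypothesis w_gt0 : forall e, (0 < w e)%N.

(** A common multiple of the w e that exceeds 1, so that the integers modulo it form a
    ring. *)
Definition residue_modulus : nat := (\prod_e w e).*2.
Local Notation M := residue_modulus.

(** The group Z/w(e) is realized inside Z/M as the multiples of M/w(e). *)
Definition residue (u : E -> int) : {ffun E -> 'Z_M} :=
  [ffun e => (u e * (M %/ w e)%N%:Z)%:~R].

Lemma residue_modulus_gt1 : (1 < M)%N.
Proof.
have : (0 < \prod_e w e)%N by apply: prodn_gt0.
by rewrite /residue_modulus -addnn; lia.
Qed.

Lemma dvdn_residue_modulus e : (w e %| M)%N.
Proof.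
by rewrite /residue_modulus (bigD1 e) //= -muln2 -mulnA dvdn_mulr.
Qed.

Lemma leq_residue_modulus e : (w e <= M)%N.
Proof.
by apply: dvdn_leq; [apply: ltnW residue_modulus_gt1 | apply: dvdn_residue_modulus].
Qed.

Lemma dvdz_residue_modulus e (a : int) :
  (M%:Z %| a * (M %/ w e)%N%:Z)%Z = ((w e)%:Z %| a)%Z.
Proof.
have ME : M%:Z = (w e)%:Z * (M %/ w e)%N%:Z.
  by rewrite -PoszM mulnC divnK // dvdn_residue_modulus.
rewrite {1}ME dvdz_mul2r // -lt0n divn_gt0 //.
exact: leq_residue_modulus.
Qed.

Lemma residueB u v : residue (fun e => u e - v e) = residue u - residue v.
Proof. by apply/ffunP=> e; rewrite !ffunE mulrBl rmorphB. Qed.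

Lemma residue_eq0 u : (residue u == 0) = [forall e, (w e %| u e)%Z].
Proof.
apply/eqP/forallP => [/ffunP ru e|wu].
  by have := ru e; rewrite !ffunE => /eqP; 
     rewrite intr_Zp_eq0 ?residue_modulus_gt1 // dvdz_residue_modulus.
by apply/ffunP=> e; apply/eqP; 
   rewrite !ffunE intr_Zp_eq0 ?residue_modulus_gt1 // dvdz_residue_modulus.
Qed.

Lemma eq_residue u v : (forall e, (w e %| u e - v e)%Z) -> residue u = residue v.
Proof.
by move=> uv; apply/eqP; rewrite -subr_eq0 -residueB residue_eq0; apply/forallP.
Qed.

Definition residues : {set {ffun E -> 'Z_M}} :=
  [set residue (fun e => (val (f e))%:Z)
     | f : {ffun E -> 'I_M} in family (fun e => [pred i : 'I_M | (i < w e)%N])].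

Lemma mem_residues u : residue u \in residues.
Proof.
have lt_w e : (`|(u e %% (w e)%:Z)%Z| < w e)%N.
  have w0 : (w e)%:Z != 0 by rewrite -lt0n.
  by have := modz_ge0 (u e) w0; have := ltz_pmod (u e) (w_gt0 e : 0 < (w e)%:Z); lia.
pose f : {ffun E -> 'I_M} := [ffun e => Ordinal (leq_trans (lt_w e) (leq_residue_modulus e))].
apply/imsetP; exists f; first by apply/familyP=> e; rewrite inE ffunE; apply: lt_w.
apply: eq_residue => e; rewrite ffunE /= gez0_abs ?modz_ge0 //; last by rewrite -lt0n.
by rewrite {1}(divz_eq (u e) (w e)) addrK dvdz_mull.
Qed.

Definition residue_type : finZmodType := {ffun E -> 'Z_M}.

Lemma residues_group : group_set (residues : {set residue_type}).
Proof.
apply/group_setP; split.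
  have -> : 1%g = residue (fun=> 0) :> {ffun E -> 'Z_M}.
    rewrite FinRing.zmod1gE; apply/esym/eqP; rewrite residue_eq0.
    by apply/forallP=> e; rewrite dvdz0.
  exact: mem_residues.
move=> _ _ /imsetP[f _ ->] /imsetP[h _ ->].
have -> : (residue (fun e => (val (f e))%:Z) * residue (fun e => (val (h e))%:Z))%g
    = residue (fun e => (val (f e))%:Z + (val (h e))%:Z).
  by rewrite FinRing.zmodMgE; apply/ffunP=> e; rewrite !ffunE mulrDl rmorphD.
exact: mem_residues.
Qed.

Lemma card_residues : #|residues| = (\prod_e w e)%N.
Proof.
rewrite card_in_imset => [|f h /familyP fw /familyP hw eq_r].
  rewrite card_family foldrE big_map big_enum /=; apply: eq_bigr => e _.
  rewrite -[RHS](card_ord (w e)) -(card_image (f := widen_ord (leq_residue_modulus e))) ?cardT.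
    apply: eq_card => i; apply/idP/imageP => [iw|[j _ ->]]; last by rewrite unfold_in /=.
    by exists (Ordinal iw) => //; apply/val_inj.
  by move=> i j /(congr1 val)/= ij; apply/val_inj.
apply/ffunP=> e; apply/val_inj.
have : residue (fun e => (val (f e))%:Z - (val (h e))%:Z) == 0 by rewrite residueB eq_r subrr.
rewrite residue_eq0 => /forallP/(_ e).
have hlt : (h e < w e)%N := hw e; have flt : (f e < w e)%N := fw e; rewrite -eqz_mod_dvd.
by rewrite !modz_nat !modn_small // => /eqP[].
Qed.

(** An abstract description that hides how the group is realized. *)
Lemma residue_group : exists (U : finZmodType) (res : (E -> int) -> U) (X : {group U}),
  [/\ forall u v, res (fun e => u e - v e) = res u - res v,
      forall u, res u = 0 <-> forall e, (w e %| u e)%Z,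
      forall u, res u \in X, forall a, a \in X -> exists u, a = res u
    & #|X| = (\prod_e w e)%N].
Proof.
exists residue_type, residue, (Group residues_group); split.
- exact: residueB.
- move=> u; split=> [u0|wu].
    by apply/forallP; rewrite -residue_eq0; apply/eqP.
  by apply/eqP; rewrite residue_eq0; apply/forallP.
- exact: mem_residues.
- by move=> _ /imsetP[f _ ->]; exists (fun e => (val (f e))%:Z).
- exact: card_residues.
Qed.
End Residues.

(** * The weight of a cover *)

Lemma image_group (U : finZmodType) (M d : nat) (psi : 'rV[int]_d -> U) :
  (0 < M)%N -> {morph psi : s s' / s - s'} -> (forall s, psi (M%:Z *: s) = 0) ->
  exists Y : {group U}, forall a, a \in Y <-> exists s, a = psi s.
Proof.
move=> M0 psiB psiM.
have psi0 : psi 0 = 0 by rewrite -(subrr (0 : 'rV_d)) psiB subrr.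
have psiD s s' : psi (s + s') = psi s + psi s'.
  have -> : s + s' = s - (0 - s') by rewrite sub0r opprK.
  by rewrite !psiB psi0 sub0r opprK.
pose Y := [set psi (\row_j (val (f j))%:Z) | f : {ffun 'I_d -> 'I_M}].
have YP a : a \in Y <-> exists s, a = psi s.
  split=> [/imsetP[f _ ->]|[s ->]]; first by exists (\row_j (val (f j))%:Z).
  have M0' : M%:Z != 0 by rewrite -lt0n.
  have lt_M j : (`|(s 0%R j %% M%:Z)%Z| < M)%N.
    by have := modz_ge0 (s 0 j) M0'; have := ltz_pmod (s 0 j) (M0 : 0 < M%:Z); lia.
  apply/imsetP; exists [ffun j => Ordinal (lt_M j)] => //.
  apply/eqP; rewrite -subr_eq0 -psiB; apply/eqP.
  rewrite -(psiM (\row_j (s 0%R j %/ M%:Z)%Z)); congr psi; apply/rowP=> j.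
  by rewrite !mxE ffunE /= gez0_abs ?modz_ge0 // {1}(divz_eq (s 0 j) M) addrK mulrC.
have gY : group_set Y.
  apply/group_setP; split; first by apply/YP; exists 0; rewrite psi0.
  by move=> _ _ /YP[s ->] /YP[s' ->]; apply/YP; exists (s + s'); rewrite psiD.
by exists (Group gY).
Qed.

Section Weight.
Variables (R : realFieldType) (n r g : nat) (P : {set 'I_n}).
Variable c : graph_cover R n r.
Hypotheses (n_gt0 : (0 < n)%N) (rE : (r + 2 = 2 * g + n)%N).
Hypothesis adm : admissible g P c.
Hypothesis exf_gt0 : forall e, (0 < exf c e)%N.
Hypothesis lft_inj : forall e f, thin (lft c e) -> lft c e = lft c f -> e = f.
Hypothesis rgt_inj : forall e f, thin (rgt c e) -> rgt c e = rgt c f -> e = f.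
Implicit Types (v u : vert c) (e f : edge c).

(** Let X be the product of the groups Z/w(e) over the long edges and Y its subgroup
    of the residues of the differences of the heights psi s. Evaluation on the cycles
    maps the integral functions on the long edges onto Z^b, with the differences of
    heights as kernel; therefore the first index is that of Y in X. The distances s
    belong to integral lengths if and only if the differences of psi s vanish in X, so
    that the second index is the order of Y. By the theorem of Lagrange the product is
    the order of X. *)
Lemma cover_weight : is_weight c ((num_aut c)%:R^-1 *
  \prod_(e : edge c | long_edge e) (exf c e)%:R
  * (- 24%:R^-1) ^+ #|[set v : vert c | (gen c v == 1%N) && (valence v == 1%N)]|).
Proof.
have pos_succ := adm_pos adm.
have [T [aT spT] vT] := card_vert_tree n_gt0 adm.
have bE : betti c = #|~: T|.
  have := betti_card n_gt0 adm; have := cardsC T; lia.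
have [z [d [z_out zbasis zd zexact]]] := cycle_space aT spT bE.
have [spv spv_thin] := fin_all_exists2 (special_nthin adm).
move=> nspv.
have spvP v : ~~ thin v -> spv (pos c v) = v.
  by move=> nv; apply: (nthin_unique n_gt0 rE adm).
have spvP' j : ~~ thin (spv j) /\ pos c (spv j) = j by [].
have [psi [psiB psiZ psi_nl psi_nthin]] := height_functions lft_inj rgt_inj pos_succ.
have [D HD] := fin_all_exists (fun i => nonlong_extension lft_inj rgt_inj pos_succ (fun=> 0) (d i)).
pose w e := if long_edge e then exf c e else 1%N.
have w_gt0 e : (0 < w e)%N by rewrite /w; case: ifP.
pose dH (H : vert c -> int) e := H (rgt c e) - H (lft c e).
(* the dual functions d, corrected so that they are supported on the long edges *)
pose d' i e := d i e - dH (D i) e.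
pose zeta (y : 'rV[int]_(betti c)) e := \sum_i y 0 i * d' i e.
have z_dH i H : \sum_e z i e * dH H e = 0.
  rewrite (eq_bigr (fun e => - (z i e * (H (lft c e) - H (rgt c e))))); last first.
    by move=> e _; rewrite /dH; ring.
  rewrite sumrN -sum_by_parts big1 ?oppr0 // => v _.
  by rewrite -/(outflow (lft c) (rgt c) (z i) v) z_out mulr0.
have zeta_nl y e : ~~ long_edge e -> zeta y e = 0.
  by move=> ne; rewrite /zeta big1 // => i _; have [_ De] := HD i; rewrite /d' /dH De // subrr mulr0.
have z_zeta i y : \sum_e z i e * zeta y e = y 0 i.
  have z_d' j : \sum_e z i e * d' j e = (i == j)%:Z.
    rewrite (eq_bigr (fun e => z i e * d j e - z i e * dH (D j) e)); last by move=> e _; rewrite mulrBr.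
    by rewrite sumrB zd z_dH subr0.
  rewrite /zeta; under eq_bigr do rewrite big_distrr /=.
  rewrite exchange_big /= (bigD1 i) //= [X in _ + X]big1 => [|j /negPf ji].
    by under eq_bigr do rewrite mulrCA; rewrite -big_distrr /= z_d' eqxx mulr1 addr0.
  by under eq_bigr do rewrite mulrCA; rewrite -big_distrr /= z_d' eq_sym ji mulr0.
have long_end e : long_edge e ->
    ~~ thin (lft c e) /\ exists2 f, bounded_chain e f & ~~ thin (rgt c f).
  by move=> /existsP[f ef]; have /and3P[nl _ nf] := ef; split=> //; exists f.
(* on the long edges, a potential that is constant along the others has the same
   differences as the heights with the corresponding distances *)
have psi_of H : (forall e, ~~ long_edge e -> H (rgt c e) = H (lft c e)) ->
    exists s, forall e, dH H e = dH (psi s) e.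
  move=> Hnl.
  pose s : 'rV[int]_r.-1 := \row_j
    (\sum_(v | (pos c v == j.+1 :> nat) && ~~ thin v) H v
     - \sum_(v | (pos c v == j :> nat) && ~~ thin v) H v).
  have sE (u v : vert c) (j : 'I_r.-1) : ~~ thin u -> ~~ thin v ->
     pos c u = j :> nat -> pos c v = j.+1 :> nat -> s 0 j = H v - H u.
    have one (w' : vert c) (m : nat) : ~~ thin w' -> pos c w' = m :> nat ->
        \sum_(v | (pos c v == m :> nat) && ~~ thin v) H v = H w'.
      move=> nw wm; rewrite (big_pred1 w') // => v' /=; apply/andP/eqP => [[/eqP vm nv]|->].
        by apply: (nthin_unique n_gt0 rE adm) => //; apply/val_inj; rewrite /= vm wm.
      by rewrite wm eqxx.
    by move=> nu nv uj vj; rewrite mxE (one v) // (one u).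
  exists s => e; case: (boolP (long_edge e)) => [le|ne]; last by rewrite /dH Hnl ?psi_nl ?subrr.
  have [nl [f /and3P[_ ef _] nf]] := long_end e le.
  rewrite /dH -(chain_const Hnl ef) -(chain_const (psi_nl s) ef) !psi_nthin //.
  by rewrite (height_difference spvP spvP' sE).
have [U [res [X [resB res0 resX Xres cardX]]]] := residue_group w_gt0.
have eq_res (u u' : edge c -> int) :
    (forall e, long_edge e -> (exf c e %| u e - u' e)%Z) -> res u = res u'.
  move=> uu; apply/eqP; rewrite -subr_eq0 -resB; apply/eqP/res0 => e.
  by rewrite /w; case: ifP => [/uu //|_]; rewrite dvd1z.
have res_dvd (u : edge c -> int) e : res u = 0 -> long_edge e -> (exf c e %| u e)%Z.
  by move=> /res0/(_ e) + le; rewrite /w le.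
pose phi s := res (dH (psi s)).
have phiB : {morph phi : s s' / s - s'}.
  move=> s s'; rewrite -resB; apply: eq_res => e _.
  by rewrite [X in (_ %| X)%Z](_ : _ = 0) ?dvdz0 // /dH !psiB; ring.
have W0 : (0 < \prod_e w e)%N by apply: prodn_gt0.
have phiM s : phi ((\prod_e w e)%N%:Z *: s) = 0.
  apply/res0 => e; rewrite /dH !psiZ -mulrBr; apply: dvdz_mulr.
  by rewrite dvdzE /= (bigD1 e) //= dvdn_mulr.
have [Y YP] := image_group W0 phiB phiM.
have sYX : Y \subset X by apply/subsetP=> a /YP[s ->]; apply: resX.
have exact_res (u : edge c -> int) : (forall e, ~~ long_edge e -> u e = 0) ->
    (forall i, \sum_e z i e * u e = 0) -> res u \in Y.
  move=> unl /zexact[H uH].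
  have [|s sH] := psi_of H; first by move=> e ne; apply/eqP; rewrite -subr_eq0 -uH unl.
  by apply/YP; exists s; apply: eq_res => e _; rewrite uH -/(dH H e) sH subrr dvdz0.
have lagr : (#|X : Y|%g * #|Y : 1|%g = \prod_e w e)%N.
  by rewrite indexg1 mulnC Lagrange.
have cyc l i : cycle_eval z l 0 i = \sum_e z i e * (if long_edge e then (exf c e)%:Z * l e else 0).
  rewrite mxE big_mkcond; apply: eq_bigr => e _.
  by case: ifP; rewrite ?mulr0 ?mulrA.
exists z, #|X : Y|%g, #|Y : 1|%g; split.
- split=> [i v|w' cw]; last by apply: zbasis => v; rewrite /outflow cw subrr.
  by have /eqP := z_out i v; rewrite /outflow subr_eq0 => /eqP.
- apply: (subgroup_index_quotient (phi := fun y => res (zeta y))) => // [y y'|a|v].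
  + rewrite -resB; apply: eq_res => e _.
    rewrite (_ : zeta (y - y') e = zeta y e - zeta y' e) ?subrr ?dvdz0 //.
    by rewrite /zeta -sumrB; apply: eq_bigr => i _; rewrite !mxE mulrBl.
  + case/Xres=> u ->.
    pose u' e := if long_edge e then u e else 0.
    exists (\row_i \sum_e z i e * u' e).
    rewrite (eq_res u u'); last first.
      by move=> e le; rewrite /u' le subrr dvdz0.
    rewrite -resB; apply: exact_res => [e ne|i].
      by rewrite zeta_nl // /u' (negPf ne) subrr.
    under eq_bigr do rewrite mulrBr.
    by rewrite sumrB z_zeta mxE subrr.
  + split=> [[l ->]|/YP[s vs]].
      pose u e := if long_edge e then (exf c e)%:Z * l e else 0.
      rewrite (_ : res _ = res (fun e => zeta (cycle_eval z l) e - u e)).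
        apply: exact_res => [e ne|i]; first by rewrite zeta_nl // /u (negPf ne) subrr.
        under eq_bigr do rewrite mulrBr.
        by rewrite sumrB z_zeta cyc subrr.
      apply: eq_res => e le; rewrite /u le opprB addrC subrK.
      by rewrite dvdz_mulr.
    have dv e : long_edge e -> (exf c e %| zeta v e - dH (psi s) e)%Z.
      by apply: (res_dvd (fun e => zeta v e - dH (psi s) e)); rewrite resB vs subrr.
    exists (fun e => ((zeta v e - dH (psi s) e) %/ (exf c e)%:Z)%Z).
    apply/rowP=> i; rewrite cyc -[LHS]z_zeta.
    transitivity (\sum_e z i e * zeta v e - \sum_e z i e * dH (psi s) e).
      by rewrite z_dH subr0.
    rewrite -sumrB; apply: eq_bigr => e _.
    rewrite -mulrBr; congr (_ * _); case: ifP => [le|/negbT ne].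
      by rewrite mulrC divzK ?dv.
    by rewrite zeta_nl // /dH psi_nl // !subrr.
- apply: (subgroup_index_quotient (phi := phi)) => [|||a /YP[s ->]|s].
  + exact: phiB.
  + exact: sub1G.
  + by move=> s; apply/YP; exists s.
  + by exists s; rewrite subrr group1.
  split=> [[l l0 [h [hl hs]]]|].
    rewrite inE; apply/eqP; rewrite FinRing.zmod1gE; apply/res0 => e.
    rewrite /w; case: ifP => [le|_]; last by rewrite dvd1z.
    have [nl [f ef nf]] := long_end e le; have /and3P[_ cef _] := ef.
    rewrite /dH -(chain_const (psi_nl s) cef) !psi_nthin //.
    by rewrite (height_difference spvP spvP' hs) // (hl e f ef) dvdz_mulr.
  rewrite inE => /eqP; rewrite FinRing.zmod1gE => s0.
  have dv e : long_edge e -> (exf c e %| dH (psi s) e)%Z by apply: (res_dvd (dH (psi s))).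
  exists (fun e => (dH (psi s) e %/ (exf c e)%:Z)%Z).
    apply/rowP=> i; rewrite cyc mxE -[RHS](z_dH i (psi s)).
    apply: eq_bigr => e _; congr (_ * _); case: ifP => [le|/negbT ne].
      by rewrite mulrC divzK ?dv.
    by rewrite /dH psi_nl // subrr.
  exists (psi s); split=> [e f ef|u v j nu nv uj vj].
    have le : long_edge e by apply/existsP; exists f.
    have /and3P[_ cef _] := ef.
    by rewrite (chain_const (psi_nl s) cef) mulrC divzK ?dv.
  rewrite !psi_nthin // -sumrB (bigD1 j) //= big1 => [|i ij].
    by rewrite uj vj ltnSn ltnn mulr1 mulr0 subr0 addr0.
  rewrite uj vj ltnS leq_eqVlt val_eqE (negPf ij) /= subrr //.
rewrite -!mulrA; congr (_ * _); rewrite mulrA; congr (_ * _).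
rewrite -natrM lagr natr_prod /w [LHS]big_mkcond /=.
by apply: eq_bigr => e _; case: ifP.
Qed.
End Weight.

(** * Bounds on the number of edges *)

Section Bounds.
Variables (R : realFieldType) (n r : nat).
Variable c : graph_cover R n r.
Hypothesis exf_gt0 : forall e, (0 < exf c e)%N.
Variables (k : int) (x : 'I_n -> int).
Hypothesis out : forall v, outflow (lft c) (rgt c) (fun e => (exf c e)%:Z) v = excess k x v.
Implicit Types (v u : vert c) (e f : edge c).

Lemma no_end_excess v : thin v -> #|[set i | endv c i == v]| = 0%N -> excess k x v = 0.
Proof.
move=> tv /eqP; rewrite cards_eq0 => /eqP/setP n0.
rewrite /excess (euler_thin tv) mulr0 subr0 big_pred0 // => i.
by have := n0 i; rewrite !inE.
Qed.

(** A thin vertex has two flags and the flow through it is balanced, so the flags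
    cannot be on the same side. *)
Lemma thin_lft_inj e f : thin (lft c e) -> lft c e = lft c f -> e = f.
Proof.
move=> te ef; apply/eqP; apply: contraT => nef.
have sub : [set e; f] \subset [set e' | lft c e' == lft c e].
  by apply/subsetP=> e'; rewrite !inE => /orP[]/eqP->; rewrite ?ef.
have := subset_leq_card sub; rewrite cards2 nef => two.
have /andP[_ /eqP] := te; rewrite /valence => val2.
have r0 : #|[set e' | rgt c e' == lft c e]| = 0%N by move: two val2; lia.
have i0 : #|[set i | endv c i == lft c e]| = 0%N by move: two val2; lia.
have := out (lft c e); rewrite no_end_excess // /outflow [X in _ - X]big_pred0; last first.
  move=> e'; move/eqP: r0; rewrite cards_eq0 => /eqP/setP/(_ e').
  by rewrite !inE.
rewrite subr0 (bigD1 e) //= => /eqP; rewrite paddr_eq0 ?sumr_ge0 //.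
by have := exf_gt0 e; case: (exf c e).
Qed.

Lemma thin_rgt_inj e f : thin (rgt c e) -> rgt c e = rgt c f -> e = f.
Proof.
move=> te ef; apply/eqP; apply: contraT => nef.
have sub : [set e; f] \subset [set e' | rgt c e' == rgt c e].
  by apply/subsetP=> e'; rewrite !inE => /orP[]/eqP->; rewrite ?ef.
have := subset_leq_card sub; rewrite cards2 nef => two.
have /andP[_ /eqP] := te; rewrite /valence => val2.
have l0 : #|[set e' | lft c e' == rgt c e]| = 0%N by move: two val2; lia.
have i0 : #|[set i | endv c i == rgt c e]| = 0%N by move: two val2; lia.
have := out (rgt c e); rewrite no_end_excess // /outflow [X in X - _]big_pred0; last first.
  move=> e'; move/eqP: l0; rewrite cards_eq0 => /eqP/setP/(_ e').
  by rewrite !inE.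
rewrite sub0r (bigD1 e) //= => /eqP; rewrite oppr_eq0 paddr_eq0 ?sumr_ge0 //.
by have := exf_gt0 e; case: (exf c e).
Qed.

Variables (g : nat) (P : {set 'I_n}).
Hypotheses (n_gt0 : (0 < n)%N) (rE : (r + 2 = 2 * g + n)%N).
Hypothesis adm : admissible g P c.

(** Every component of the graph of the edges that are not long contains a vertex that
    is not thin: otherwise a long edge would enter it, and the chain of this edge
    would end in it. Hence there are at least #|V| - r edges that are not long, and
    the rest follows from the formula for the Betti number. *)
Lemma card_long_edge :
  (#|[set e : edge c | long_edge e]| + betti c + 3 <= 4 * g + n)%N.
Proof.
have vert_le : (#|vert c| <= #|[set e : edge c | ~~ long_edge e]| + r)%N.
  rewrite -[X in (_ + X)%N](card_nthin n_gt0 rE adm).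
  apply: (card_vertices_le (l := lft c) (r := rgt c)) => S Snl dS.
  have Sthin v : v \in S -> thin v.
    by move=> vS; have := disjointFr dS vS; rewrite inE => /negbFE.
  apply/setP=> v; rewrite [RHS]inE; apply/negP=> vS.
  have [u _ nu] := special_nthin adm (pos c v).
  have [e cross] : exists e, (lft c e \in S) != (rgt c e \in S).
    apply/existsP; apply: contraT => /existsPn noe.
    have := closed_connect (S := S) _ (adm_spanning adm v u).
    rewrite vS => /(_ (fun e _ => eqP (negPn (noe e))))/esym/Sthin tu.
    by rewrite tu in nu.
  have le : long_edge e.
    by apply: contraNT cross => ne; apply/eqP/Snl; rewrite inE.
  have /existsP[f /and3P[nl ef nf]] := le.
  have nS : lft c e \notin S by apply: contra nl => /Sthin.
  have rS : rgt c e \in S by move: cross; rewrite (negPf nS); case: (_ \in S).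
  have := chain_const (H := fun v => (v \in S)%:Z) _ ef; rewrite rS.
  case: (boolP (rgt c f \in S)) => [/Sthin tf|_]; first by rewrite tf in nf.
  by move=> /(_ _)/= H; have : 0 = 1 :> int by apply: H => e' ne'; rewrite Snl ?inE.
have := cardsC [set e : edge c | long_edge e].
rewrite (_ : ~: _ = [set e : edge c | ~~ long_edge e]); last by apply/setP=> e; rewrite !inE.
have := betti_card n_gt0 adm; have := adm_genus adm; lia.
Qed.

(** From one position to the next, the number of edges grows by at most 3 at the
    special vertex and by at most n at thin vertices that carry an end. *)
Lemma card_slice (j : nat) :
  (#|[set e : edge c | pos c (lft c e) == j :> nat]| <= j.+1 * (n + 3))%N.
Proof.
have fiber (T : finType) (s : T -> vert c) (m : nat) :
    #|[set e | pos c (s e) == m :> nat]|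
    = (\sum_(v | pos c v == m :> nat) #|[set e | s e == v]|)%N.
  have := fiber_card s [set v | pos c v == m :> nat].
  under eq_bigl do rewrite inE; move=> ->.
  by apply: eq_card => e; rewrite !inE.
have step m : (#|[set e : edge c | pos c (lft c e) == m :> nat]|
    <= #|[set e : edge c | pos c (rgt c e) == m :> nat]| + (n + 3))%N.
  rewrite (fiber _ (rgt c)) (fiber _ (lft c)) addnA.
  have : (\sum_(v | pos c v == m :> nat) #|[set i | endv c i == v]| <= n)%N.
    by rewrite -fiber -[X in (_ <= X)%N](card_ord n) max_card.
  have : (\sum_(v : vert c | pos c v == m :> nat) (~~ thin v) * 3 <= 3)%N.
    case: (pickP (fun v : vert c => (pos c v == m :> nat) && ~~ thin v)) => [u /andP[/eqP um nu]|no].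
      rewrite (bigD1 u) ?um //= big1 => [|v /andP[/eqP vm nvu]]; first by rewrite nu.
      case: (boolP (thin v)) => // nv; case/eqP: nvu.
      by apply: (nthin_unique n_gt0 rE adm) => //; apply/val_inj; rewrite /= vm um.
    rewrite big1 // => v vm; have := no v; rewrite vm /= => /negbFE ->.
    by [].
  have : (\sum_(v | pos c v == m :> nat) #|[set e | lft c e == v]| <=
    \sum_(v | pos c v == m :> nat) (#|[set e | rgt c e == v]| + #|[set i | endv c i == v]|
       + (~~ thin v) * 3))%N.
    apply: leq_sum => v _; case: (boolP (thin v)) => tv /=.
      have le1 : (#|[set e | lft c e == v]| <= 1)%N.
        rewrite leqNgt; apply/negP=> /card_gt1P[e [f [ev fv nef]]].
        rewrite !inE in ev fv; case/eqP: nef; apply: thin_lft_inj; rewrite (eqP ev) //.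
        by rewrite (eqP fv).
      have /andP[_ /eqP] := tv; rewrite /valence mul0n addn0.
      by move: le1; set a := #|_|; set b := #|_|; set d := #|_|; lia.
    have := euler_nthin n_gt0 rE adm tv; rewrite /euler /valence mul1n.
    by set a := #|_|; set b := #|_|; set d := #|_|; lia.
  rewrite !big_split /=; lia.
elim: j => [|j IHj]; apply: leq_trans (step _) _.
  rewrite mul1n -[X in (_ <= X)%N]add0n leq_add2r leqn0 cards_eq0.
  by apply/eqP/setP=> e; rewrite !inE (adm_pos adm).
rewrite [X in (_ <= X)%N]mulSn addnC leq_add2l; apply: leq_trans IHj.
by apply: subset_leq_card; apply/subsetP=> e; rewrite !inE (adm_pos adm) eqSS.
Qed.

Lemma card_edge_bound : (#|edge c| <= r * (r * (n + 3)))%N.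
Proof.
rewrite -[#|edge c|]cardsT -sum1_card (partition_big (fun e => pos c (lft c e)) xpredT) //=.
rewrite -[X in (_ <= X * _)%N](card_ord r) -sum_nat_const; apply: leq_sum => j _.
apply: (@leq_trans (j.+1 * (n + 3))); last by rewrite leq_mul2r ltn_ord orbT.
apply: leq_trans (card_slice j); rewrite -sum1_card; apply: eq_leq.
by apply: eq_bigl => e; rewrite !inE.
Qed.
End Bounds.

(** * Invariance under isomorphism *)

Section Isomorphism.
Variables (R : realFieldType) (n r : nat).
Implicit Types c d : graph_cover R n r.

Lemma preservesP c d (fV : vert c -> vert d) (fE : edge c -> edge d) :
  reflect [/\ forall v, gen d (fV v) = gen c v /\ pos d (fV v) = pos c v,
              forall e, lft d (fE e) = fV (lft c e) /\ rgt d (fE e) = fV (rgt c e),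
              forall e, len d (fE e) = len c e /\ exf d (fE e) = exf c e
            & forall i, endv d i = fV (endv c i)]
          (preserves fV fE).
Proof.
apply: (iffP and5P) => [[/forallP g1 /forallP p1 /forallP l1 /forallP r1
  /and3P[/forallP n1 /forallP x1 /forallP i1]]|[gp lr nx i1]].
  by split=> [v|e|e|i]; [split; apply/eqP|split; apply/eqP|split; apply/eqP|apply/eqP].
by split; last (apply/and3P; split); apply/forallP=> a; apply/eqP;
  [case: (gp a)|case: (gp a)|case: (lr a)|case: (lr a)|case: (nx a)|case: (nx a)|].
Qed.

Lemma isomorphic_sym c d : isomorphic c d -> isomorphic d c.
Proof.
case=> fV [fE [[gV VK KV] [gE EK KE] /preservesP[gp lr nx iE]]].
exists gV, gE; split; [by exists fV | by exists fE | apply/preservesP; split=> [v|e|e|i]].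
- by rewrite -{2 4}(KV v); case: (gp (gV v)) => -> ->.
- by rewrite -{2 4}(KE e); case: (lr (gE e)) => -> ->; rewrite !VK.
- by rewrite -{2 4}(KE e); case: (nx (gE e)) => -> ->.
- by rewrite iE VK.
Qed.

Lemma isomorphic_trans c d d' : isomorphic c d -> isomorphic d d' -> isomorphic c d'.
Proof.
case=> fV [fE [bV bE /preservesP[gp lr nx iE]]] [hV [hE [bV' bE' /preservesP[gp' lr' nx' iE']]]].
exists (hV \o fV), (hE \o fE); split; [exact: bij_comp | exact: bij_comp | apply/preservesP].
split=> [v|e|e|i] /=.
- by case: (gp' (fV v)) => -> ->.
- by case: (lr' (fE e)) => -> ->; case: (lr e) => -> ->.
- by case: (nx' (fE e)) => -> ->.
- by rewrite iE' iE.
Qed.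

Section Invariance.
Variables (c d : graph_cover R n r) (fV : vert c -> vert d) (fE : edge c -> edge d).
Hypotheses (bV : bijective fV) (bE : bijective fE) (pr : preserves fV fE).

Let genE v : gen d (fV v) = gen c v.
Proof. by case/preservesP: pr => H _ _ _; case: (H v). Qed.
Let posE v : pos d (fV v) = pos c v.
Proof. by case/preservesP: pr => H _ _ _; case: (H v). Qed.
Let lftE e : lft d (fE e) = fV (lft c e).
Proof. by case/preservesP: pr => _ H _ _; case: (H e). Qed.
Let rgtE e : rgt d (fE e) = fV (rgt c e).
Proof. by case/preservesP: pr => _ H _ _; case: (H e). Qed.
Let lenE e : len d (fE e) = len c e.
Proof. by case/preservesP: pr => _ _ H _; case: (H e). Qed.
Let exfE e : exf d (fE e) = exf c e.
Proof. by case/preservesP: pr => _ _ H _; case: (H e). Qed.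
Let endE i : endv d i = fV (endv c i).
Proof. by case/preservesP: pr. Qed.

Let fV_eq u v : (fV u == fV v) = (u == v).
Proof. exact/inj_eq/bij_inj. Qed.

Let sum_edge (Q : edge d -> bool) (F : edge d -> nat) :
  (\sum_(e | Q e) F e = \sum_(e | Q (fE e)) F (fE e))%N.
Proof. exact/reindex/onW_bij. Qed.

Lemma iso_valence v : valence (fV v) = valence v.
Proof.
rewrite /valence -!sum1dep_card !sum_edge.
by congr (_ + _ + _)%N; apply: eq_bigl => e; rewrite ?lftE ?rgtE ?endE fV_eq.
Qed.

Lemma iso_thin v : thin (fV v) = thin v.
Proof. by rewrite /thin genE iso_valence. Qed.

Lemma iso_continues e f : continues (fE e) (fE f) = continues e f.
Proof. by rewrite /continues rgtE lftE fV_eq iso_thin. Qed.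

Lemma iso_connect (T T' : finType) (h : T -> T') (e1 : rel T) (e2 : rel T') x y :
  bijective h -> (forall a b, e2 (h a) (h b) = e1 a b) ->
  connect e2 (h x) (h y) = connect e1 x y.
Proof.
move=> [h' hK Kh] eh; apply/idP/idP.
  suff lift a b : connect e2 a b -> connect e1 (h' a) (h' b) by move/lift; rewrite !hK.
  move=> /connectP[p + ->]; elim: p a => //= a' p IHp a /andP[aa' /IHp].
  by apply: connect_trans; apply: connect1; rewrite -eh !Kh.
move=> /connectP[p + ->]; elim: p x => //= a' p IHp a /andP[aa' /IHp].
by apply: connect_trans; apply: connect1; rewrite eh.
Qed.

Lemma iso_long_edge e : long_edge (fE e) = long_edge e.
Proof.
have chainE f : bounded_chain (fE e) (fE f) = bounded_chain e f.
  rewrite /bounded_chain lftE rgtE !iso_thin.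
  by rewrite (iso_connect _ _ bE iso_continues).
case: bE => gE EK KE; apply/existsP/existsP => -[f ef].
  by exists (gE f); rewrite -chainE KE.
by exists (fE f); rewrite chainE.
Qed.

Lemma iso_card_genus1 :
  #|[set v : vert d | (gen d v == 1%N) && (valence v == 1%N)]|
  = #|[set v : vert c | (gen c v == 1%N) && (valence v == 1%N)]|.
Proof.
rewrite -!sum1dep_card (reindex fV) /=; last exact: onW_bij.
by apply: eq_bigl => v; rewrite genE iso_valence.
Qed.

Lemma iso_long_product (A : comRingType) :
  \prod_(e : edge d | long_edge e) (exf d e)%:R
  = \prod_(e : edge c | long_edge e) (exf c e)%:R :> A.
Proof.
rewrite (reindex fE) /=; last exact: onW_bij.
by apply: eq_big => [e|e _]; rewrite ?iso_long_edge ?exfE.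
Qed.

Lemma iso_leaky g k x t : is_leaky_cover g k x t c -> is_leaky_cover g k x t d.
Proof.
have [gV VK KV] := bV; have [gE EK KE] := bE.
have allV (Q : vert d -> Prop) : (forall v, Q (fV v)) -> forall v, Q v.
  by move=> QV v; rewrite -(KV v).
have allE (Q : edge d -> Prop) : (forall e, Q (fE e)) -> forall e, Q e.
  by move=> QE e; rewrite -(KE e).
case=> conn gen_c len0 exf0 aff inner lend rend surj leaky stab spec; split.
- apply: (allV _) => u; apply: (allV _) => v.
  rewrite (iso_connect (e1 := @adjacent R n r c)) // => a b.
  apply/existsP/existsP => -[e ab].
    by exists (gE e); rewrite -!(fV_eq, lftE, rgtE) KE.
  by exists (fE e); rewrite !(lftE, rgtE, fV_eq).
- rewrite gen_c /betti (bij_eq_card bV) (bij_eq_card bE); congr (_ + _)%N.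
  by rewrite [RHS](reindex fV) /=; [apply: eq_bigr | apply: onW_bij].
- by apply: (allE _) => e; rewrite lenE.
- by apply: (allE _) => e; rewrite exfE.
- by apply: (allE _) => e; rewrite exfE lenE lftE rgtE !posE.
- by apply: (allE _) => e j; rewrite lftE rgtE !posE; apply: inner.
- by move=> i j; rewrite endE posE; apply: lend.
- by move=> i j; rewrite endE posE; apply: rend.
- move=> y; case: (surj y) => [[v yv]|[e ye]|[i xi yi]|[i xi yi]].
  + by constructor 1; exists (fV v); rewrite posE.
  + by constructor 2; exists (fE e); rewrite lftE rgtE !posE.
  + by constructor 3; exists i; rewrite ?endE ?posE.
  + by constructor 4; exists i; rewrite ?endE ?posE.
- apply: (allV _) => v; rewrite genE iso_valence -leaky /left_degree /right_degree !sum_edge.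
  congr ((_ + _)%N%:Z - (_ + _)%N%:Z).
  + by apply: eq_big => [e|e _]; rewrite ?rgtE ?fV_eq ?exfE.
  + by apply: eq_bigl => i; rewrite endE fV_eq.
  + by apply: eq_big => [e|e _]; rewrite ?lftE ?fV_eq ?exfE.
  + by apply: eq_bigl => i; rewrite endE fV_eq.
- by apply: (allV _) => v; rewrite genE iso_valence; apply: stab.
- by move=> j; have [v vj vs] := spec j; exists (fV v); rewrite ?posE ?genE ?iso_valence.
Qed.
End Invariance.
End Isomorphism.

(** * Numbered graphs *)

(** The orbit of y has #|aT| / #|stabilizer of y| elements, and F is constant on it. *)
Lemma orbit_sum (aT : finGroupType) (T : finType) (to : {action aT &-> T})
    (S : {set T}) (F : T -> rat) :
  (forall x a, (to x a \in S) = (x \in S)) -> (forall x a, F (to x a) = F x) ->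
  exists reps : {set T}, [/\ reps \subset S,
    forall x, x \in S -> exists! y, y \in reps /\ y \in orbit to setT x
    & \sum_(y in reps) #|'C_setT[y | to]%g|%:R^-1 * F y = #|aT|%:R^-1 * \sum_(x in S) F x].
Proof.
move=> S_to F_to.
(* a representative that depends only on the orbit as a set *)
pose rep x := odflt x [pick y in orbit to setT x].
have rep_orbit x : rep x \in orbit to setT x.
  by rewrite /rep; case: pickP => [y //|]; rewrite orbit_refl.
have rep_eq x y : y \in orbit to setT x -> rep y = rep x.
  move=> yx; rewrite /rep; have eq_o : orbit to setT y = orbit to setT x.
    by apply/esym/orbit_eqP; rewrite orbit_sym.
  by rewrite eq_o; case: pickP => [//|/(_ y)]; rewrite yx.
have orbitS x y : y \in orbit to setT x -> (y \in S) = (x \in S).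
  by case/orbitP=> a _ <-.
have orbitF x y : y \in orbit to setT x -> F y = F x.
  by case/orbitP=> a _ <-.
exists (rep @: S); split.
- by apply/subsetP=> _ /imsetP[x Sx ->]; rewrite (orbitS x).
- move=> x Sx; exists (rep x); split; first by split; [apply: imset_f | apply: rep_orbit].
  move=> _ [/imsetP[z _ ->] zx]; rewrite -(rep_eq _ _ zx).
  by apply/esym; rewrite (rep_eq _ _ (rep_orbit z)).
rewrite [in RHS](partition_big_imset rep) big_distrr /=; apply: eq_bigr => _ /imsetP[z Sz ->].
set y := rep z.
have repy : rep y = y by rewrite /y (rep_eq _ _ (rep_orbit z)).
have -> : \sum_(i in S | rep i == y) F i = \sum_(i in orbit to setT y) F y.
  apply: eq_big => [i|i /andP[_ /eqP ry]]; last first.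
    by rewrite -(orbitF i y) // -ry rep_orbit.
  apply/andP/idP => [[_ /eqP <-]|iy]; first by rewrite orbit_sym rep_orbit.
  by rewrite (orbitS _ _ iy) (orbitS _ _ (rep_orbit z)) Sz (rep_eq _ _ iy) repy.
rewrite sumr_const -[F y *+ _]mulr_natl mulrA; congr (_ * _).
have := card_orbit_stab to setT y; rewrite cardsT => <-.
rewrite natrM invfM mulrAC mulVf ?mul1r // pnatr_eq0 -lt0n.
by apply/card_gt0P; exists y; apply: orbit_refl.
Qed.

Section Labelled.
Variables (R : realFieldType) (n r g a b : nat) (t : 'I_r -> R).

(** Genera, left and right ends of edges, ends, and positions of a graph with a
    numbered vertices and b numbered edges. The bound on the genera makes the type
    finite. *)
Definition shape : finType :=
  ({ffun 'I_a -> 'I_g.+1} * {ffun 'I_b -> 'I_a} * {ffun 'I_b -> 'I_a}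
   * {ffun 'I_n -> 'I_a} * {ffun 'I_a -> 'I_r})%type.

Implicit Types s : shape.

Definition labelled s (f : 'I_b -> nat) : graph_cover R n r :=
  {| vert := 'I_a; edge := 'I_b; gen := fun v => s.1.1.1.1 v; lft := s.1.1.1.2;
     rgt := s.1.1.2; endv := s.1.2;
     len := fun e => (t (s.2 (s.1.1.2 e)) - t (s.2 (s.1.1.1.2 e))) / (f e)%:R;
     exf := f; pos := s.2 |}.

Section Relabel.
Variable B : nat.
Implicit Types x : (shape * {ffun 'I_b -> 'I_B})%type.

Definition cover_of x : graph_cover R n r := labelled x.1 (fun e => x.2 e).

Definition relabel x (pq : {perm 'I_a} * {perm 'I_b}) : (shape * {ffun 'I_b -> 'I_B})%type :=
  let: (p, q) := pq in
  let: (ge, lf, ri, en, po) := x.1 in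
  (([ffun v => ge (p^-1%g v)], [ffun e => p (lf (q^-1%g e))], [ffun e => p (ri (q^-1%g e))],
    [ffun i => p (en i)], [ffun v => po (p^-1%g v)]), [ffun e => x.2 (q^-1%g e)]).

Lemma relabel1 x : relabel x 1%g = x.
Proof.
case: x => [[[[[ge lf] ri] en] po] f]; rewrite /relabel /=.
by congr (_, _, _, _, _, _); apply/ffunP=> i; rewrite ffunE ?invg1 ?perm1.
Qed.

Lemma relabelM x pq pq' : relabel x (pq * pq')%g = relabel (relabel x pq) pq'.
Proof.
case: x pq pq' => [[[[[ge lf] ri] en] po] f] [p q] [p' q']; rewrite /relabel /=.
by congr (_, _, _, _, _, _); apply/ffunP=> i; rewrite !ffunE ?invMg ?permM.
Qed.

Canonical relabel_action := TotalAction relabel1 relabelM.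

Lemma relabel_preserves x y (p : {perm 'I_a}) (q : {perm 'I_b}) :
  preserves (c := cover_of x) (d := cover_of y) p q = (relabel x (p, q) == y).
Proof.
case: x y => [[[[[ge lf] ri] en] po] f] [[[[[ge' lf'] ri'] en'] po'] f'].
apply/preservesP/eqP => /= [[gp lr nx iE]|[<- <- <- <- <- <-]].
  congr (_, _, _, _, _, _); apply/ffunP=> i; rewrite ffunE.
  - by apply/val_inj; rewrite -[i in RHS](permKV p); case: (gp (p^-1%g i)).
  - by rewrite -[i in RHS](permKV q); case: (lr (q^-1%g i)).
  - by rewrite -[i in RHS](permKV q); case: (lr (q^-1%g i)).
  - by rewrite iE.
  - by rewrite -[i in RHS](permKV p); case: (gp (p^-1%g i)).
  - by apply/val_inj; rewrite -[i in RHS](permKV q); case: (nx (q^-1%g i)).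
by split=> [v|e|e|i]; rewrite !ffunE ?permK.
Qed.

Lemma cover_iso_orbit x y :
  isomorphic (cover_of x) (cover_of y) <-> y \in orbit relabel_action setT x.
Proof.
split=> [[fV [fE [bV bE pr]]]|/orbitP[[p q] _ xy]].
  apply/orbitP; exists (perm (bij_inj bV), perm (bij_inj bE)); rewrite ?inE //.
  apply/eqP; rewrite /= -relabel_preserves; apply/preservesP.
  case/preservesP: pr => gp lr nx iE.
  by split=> [v|e|e|i]; rewrite !permE.
by exists p, q; split; [exact/injF_bij/perm_inj|exact/injF_bij/perm_inj|];
  rewrite relabel_preserves; apply/eqP.
Qed.

Lemma num_aut_stabilizer x :
  num_aut (cover_of x) = #|'C_setT[x | relabel_action]%g|.
Proof.
rewrite setTI; apply: eq_card => -[p q]; rewrite inE /= relabel_preserves.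
by apply/eqP/astab1P.
Qed.

End Relabel.
End Labelled.

(** * Flow sums over the covers of a given shape *)

Section LeakyNumber.
Variables (R : realFieldType) (n r g : nat) (P : {set 'I_n}) (k : int).
Hypotheses (n_gt0 : (0 < n)%N) (rE : (r + 2 = 2 * g + n)%N).
Variable y : 'I_n -> int.
Hypothesis y_domain : in_domain g k P y.

(** The conditions in [admissible], the long edges and the excesses of a shape do not
    depend on lengths and expansion factors, so both are filled in arbitrarily. *)
Definition skeleton a b (s : shape n r g a b) : graph_cover R n r :=
  labelled (fun=> 0) s (fun=> 1%N).

Definition long_product a b (s : shape n r g a b) (f : 'I_b -> int) : rat :=
  \prod_(e : edge (skeleton s) | long_edge e) (f e)%:~R.

Lemma shape_flow_polyfun a b (s : shape n r g a b) : admissible g P (skeleton s) ->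
  exists2 phi : ('I_n -> int) -> rat, polyfun (4 * g + n - 3) phi &
  forall x B, in_domain g k P x -> same_region g k y x ->
    \sum_v `|excess (c := skeleton s) k x v| < B%:Z ->
    \sum_(f : {ffun 'I_b -> 'I_B} |
       flow (lft (skeleton s)) (rgt (skeleton s)) setT (excess k x) [ffun e => (f e)%:Z])
      long_product s (fun e => (f e)%:Z) = phi x.
Proof.
move=> adm; set c := skeleton s.
have [T [aT spT] vT] := card_vert_tree n_gt0 adm.
pose Reg x := in_domain g k P x /\ same_region g k y x.
have Ry : Reg y by [].
have rank_lt (e : edge c) : (pos c (lft c e) < pos c (rgt c e))%N by rewrite (adm_pos adm).
have beta_poly (v : vert c) : polyfun 1 (fun x => (excess k x v)%:~R).
  apply: (@polyfun_ext _ _ (fun x => \sum_(i | endv c i == v) (x i)%:~R + - (k * euler v)%:~R)).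
    by move=> x; rewrite /excess intrD rmorph_sum mulrNz.
  apply: polyfun_add; last exact: polyfun_const.
  by apply: polyfun_sum => i _; apply: polyfun_var.
have beta_total x : Reg x -> \sum_(v : vert c) excess k x v = 0.
  by case=> xd _; apply: (excess_total n_gt0 rE adm xd).
have beta_sign (T' : {set edge c}) e x : acyclic (lft c) (rgt c) T' ->
    spanning (lft c) (rgt c) T' -> e \in T' -> Reg x ->
    Num.sg (\sum_(v in cut_side (lft c) (rgt c) T' e) excess k x v)
    = Num.sg (\sum_(v in cut_side (lft c) (rgt c) T' e) excess k y v).
  by move=> aT' spT' Te' [xd xr]; apply: (excess_sign n_gt0 rE adm).
have pw : polyfun #|[set e : edge c | long_edge e]| (long_product s).
  rewrite cardsE cardE size_filter; apply: polyfun_prod => e _; exact: polyfun_var.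
have aX : acyclic (lft c) (rgt c) (setT :\: ~: T) by rewrite setTD setCK.
have [phi pphi ephi] := @flow_sum_polyfun _ _ (lft c) (rgt c) (fun v => pos c v)
  (endv c (Ordinal n_gt0)) rank_lt (adm_spanning adm)
  _ _ _ _ Ry beta_poly beta_total beta_sign _ _ _ _ aX pw.
exists phi.
  have cycles : #|~: T| = betti c.
    by have := betti_card n_gt0 adm; have := cardsC T; rewrite -/c in vT *; lia.
  have long_le := card_long_edge n_gt0 rE adm.
  by apply: polyfunW pphi; rewrite cycles -(leq_add2r 3) subnK // (leq_trans _ long_le) ?leq_addl.
move=> x B xd xr xB; rewrite -(ephi x B) //.
rewrite /flow_sum /box big_map big_enum_cond /=; apply: eq_bigr => f _.
by apply: eq_bigr => e _; rewrite ffunE.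
Qed.

Hypothesis r_gt0 : (0 < r)%N.

(** The expansion factors are a nonnegative flow and hence bounded in terms of the
    excesses. *)
Lemma label_cover x (t : 'I_r -> R) B (d : graph_cover R n r) : line_graph t -> in_domain g k P x ->
  is_leaky_cover g k x t d ->
  (forall a b (s : shape n r g a b), #|vert d| = a -> #|edge d| = b ->
     \sum_v `|excess (c := skeleton s) k x v| < B%:Z) ->
  exists z : shape n r g #|vert d| #|edge d| * {ffun 'I_#|edge d| -> 'I_B},
    isomorphic d (cover_of t z).
Proof.
move=> tP xd dL dB; have [adm exf0 out] := leaky_admissible r_gt0 tP xd dL.
have gen_le (v : vert d) : (gen d v < g.+1)%N.
  by rewrite ltnS (adm_genus adm) (bigD1 v) //= addnCA leq_addr.
pose s : shape n r g #|vert d| #|edge d| :=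
  ([ffun v => Ordinal (gen_le (enum_val v))],
   [ffun e => enum_rank (lft d (enum_val e))], [ffun e => enum_rank (rgt d (enum_val e))],
   [ffun i => enum_rank (endv d i)], [ffun v => pos d (enum_val v)]).
have iso_s (f : 'I_#|edge d| -> nat) : (forall e, f e = exf d (enum_val e)) ->
    isomorphic d (labelled t s f).
  move=> fE; exists enum_rank, enum_rank; split.
  - by exists enum_val; [apply: enum_rankK | apply: enum_valK].
  - by exists enum_val; [apply: enum_rankK | apply: enum_valK].
  - apply/preservesP; split=> [v|e|e|i]; rewrite /= ?ffunE ?enum_rankK //.
    rewrite fE enum_rankK; split=> //; rewrite -(lc_affine dL) mulrAC divff ?mul1r //.
    by rewrite pnatr_eq0 -lt0n.
pose f0 (e : 'I_#|edge d|) := exf d (enum_val e).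
have iso0 : isomorphic d (labelled t s f0) by apply: iso_s.
have dL' : is_leaky_cover g k x t (labelled t s f0).
  by case: iso0 => fV [fE [bV bE pr]]; apply: (iso_leaky bV bE pr dL).
have [adm' _ out'] := leaky_admissible r_gt0 tP xd dL'.
have fB e : (f0 e < B)%N.
  rewrite -ltz_nat; apply: le_lt_trans (dB _ _ s erefl erefl).
  pose c' := labelled t s f0.
  have rank_lt (e' : edge c') : (pos c' (lft c' e') < pos c' (rgt c' e'))%N.
    by rewrite (adm_pos adm').
  have c0 (e' : edge c') : 0 <= (exf c' e')%:Z by [].
  have := @flow_bound _ _ _ _ (fun v => pos c' v) rank_lt _ _ e c0 out'.
  exact.
exists (s, [ffun e => Ordinal (fB e)]); apply: iso_s => e; rewrite /= ffunE //.
Qed.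
End LeakyNumber.

(** * The leaky number as a sum over numbered covers *)

Section Assembly.
Variables (R : realFieldType) (n g : nat) (P : {set 'I_n}) (k : int).
Local Notation r := (2 * g + n - 2)%N.
Hypotheses (n_gt0 : (0 < n)%N) (r_gt0 : (0 < r)%N).
Variable y : 'I_n -> int.
Hypothesis y_domain : in_domain g k P y.

Let rE : (r + 2 = 2 * g + n)%N.
Proof. by move: r_gt0; lia. Qed.

Definition size_bound : nat := (r * (r * (n + 3))).+2.

Definition genus1_ends a b (s : shape n r g a b) : nat :=
  #|[set v : vert (skeleton R s) | (gen (skeleton R s) v == 1%N) && (valence v == 1%N)]|.

Definition labelled_weight a b B (t : 'I_r -> R)
    (z : shape n r g a b * {ffun 'I_b -> 'I_B}) : rat :=
  \prod_(e : edge (cover_of t z) | long_edge e) (exf (cover_of t z) e)%:R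
  * (- 24%:R^-1) ^+ #|[set v : vert (cover_of t z)
                       | (gen (cover_of t z) v == 1%N) && (valence v == 1%N)]|.

Definition leaky_labelled a b B x : {set shape n r g a b * {ffun 'I_b -> 'I_B}} :=
  [set z : shape n r g a b * {ffun 'I_b -> 'I_B} | admissible g P (skeleton R z.1) &&
    flow (lft (skeleton R z.1)) (rgt (skeleton R z.1)) setT (excess k x) [ffun e => (z.2 e)%:Z]].

Lemma leaky_labelledP a b B x (t : 'I_r -> R) z : line_graph t -> in_domain g k P x ->
  reflect (is_leaky_cover g k x t (cover_of t z)) (z \in @leaky_labelled a b B x).
Proof.
move=> tP xd; rewrite inE; apply: (iffP andP) => [[adm /flowP[f0 _ fb]]|zL].
  apply: (admissible_leaky (P := P)) => //.
    by move=> e; have := f0 e; rewrite inE ffunE => /(_ isT).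
  move=> v; rewrite -[RHS](fb v); apply: eq_outflow => e.
  by rewrite ffunE.
have [adm f0 fb] := leaky_admissible r_gt0 tP xd zL; split=> //.
apply/flowP; split=> [e _|e|v]; first by rewrite ffunE; apply: (f0 e).
  by rewrite inE.
by rewrite -[RHS](fb v); apply: eq_outflow => e; rewrite ffunE.
Qed.

Lemma labelled_is_weight a b B x (t : 'I_r -> R) (z : shape n r g a b * {ffun 'I_b -> 'I_B}) :
  line_graph t -> in_domain g k P x -> is_leaky_cover g k x t (cover_of t z) ->
  is_weight (cover_of t z)
    (#|'C_setT[z | relabel_action n r g a b B]%g|%:R^-1 * labelled_weight t z).
Proof.
move=> tP xd zL; have [adm f0 fb] := leaky_admissible r_gt0 tP xd zL.
rewrite -(num_aut_stabilizer t) /labelled_weight mulrA.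
exact: (cover_weight n_gt0 rE adm f0 (thin_lft_inj f0 fb) (thin_rgt_inj f0 fb)).
Qed.

(** For each admissible shape, the weighted sum over the expansion factors is a flow
    sum. *)
Lemma labelled_sum_polyfun a b : exists2 phi : ('I_n -> int) -> rat,
  polyfun (4 * g + n - 3) phi &
  forall x B (t : 'I_r -> R), in_domain g k P x -> same_region g k y x ->
    (forall s : shape n r g a b, \sum_v `|excess (c := skeleton R s) k x v| < B%:Z) ->
    \sum_(z in @leaky_labelled a b B x) labelled_weight t z = phi x.
Proof.
have step (s : shape n r g a b) : exists phi : ('I_n -> int) -> rat,
    admissible g P (skeleton R s) -> polyfun (4 * g + n - 3) phi /\
    forall x B, in_domain g k P x -> same_region g k y x ->
    \sum_v `|excess (c := skeleton R s) k x v| < B%:Z ->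
    \sum_(f : {ffun 'I_b -> 'I_B} |
       flow (lft (skeleton R s)) (rgt (skeleton R s)) setT (excess k x) [ffun e => (f e)%:Z])
      long_product R s (fun e => (f e)%:Z) = phi x.
  case: (boolP (admissible g P (skeleton R s))) => [adm|_]; last by exists (fun=> 0).
  by have [phi pphi ephi] := shape_flow_polyfun n_gt0 rE y_domain adm; exists phi.
have [phi Hphi] := fin_all_exists step.
exists (fun x => \sum_(s | admissible g P (skeleton R s)) (- 24%:R^-1) ^+ genus1_ends s * phi s x).
  by apply: polyfun_sum => s /Hphi[ps _]; apply: polyfun_scale.
move=> x B t xd xr xB.
pose Q (s : shape n r g a b) (f : {ffun 'I_b -> 'I_B}) :=
  flow (lft (skeleton R s)) (rgt (skeleton R s)) setT (excess k x) [ffun e => (f e)%:Z].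
rewrite (eq_bigl (fun z => admissible g P (skeleton R z.1) && Q z.1 z.2)); last first.
  by move=> z; rewrite inE.
rewrite -(pair_big_dep (fun s => admissible g P (skeleton R s)) Q
   (fun s f => labelled_weight t (s, f))) /=.
apply: eq_bigr => s adm; have [_ ephi] := Hphi s adm.
rewrite -(ephi x B xd xr (xB s)).
rewrite big_distrr /=; apply: eq_bigr => f _.
rewrite mulrC /labelled_weight; congr (_ * _).
Qed.
Lemma labelled_weight_relabel a b B (t : 'I_r -> R) z pq :
  labelled_weight t (@relabel n r g a b B z pq) = labelled_weight t z.
Proof.
have /cover_iso_orbit-/(_ R t) [fV [fE [bV bE pr]]] :
    relabel z pq \in orbit (relabel_action n r g a b B) setT z by apply: mem_orbit.
by rewrite /labelled_weight (iso_long_product bV bE pr) (iso_card_genus1 bV bE pr).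
Qed.

Lemma leaky_labelled_relabel a b B x (t : 'I_r -> R) z pq :
  line_graph t -> in_domain g k P x ->
  (@relabel n r g a b B z pq \in leaky_labelled a b B x) = (z \in leaky_labelled a b B x).
Proof.
move=> tP xd.
have iso : isomorphic (cover_of t z) (cover_of t (relabel z pq)).
  by apply/cover_iso_orbit; apply: (mem_orbit (relabel_action n r g a b B)).
apply/(leaky_labelledP _ tP xd)/(leaky_labelledP _ tP xd) => zL.
  by have [fV [fE [bV bE pr]]] := isomorphic_sym iso; apply: (iso_leaky bV bE pr).
by have [fV [fE [bV bE pr]]] := iso; apply: (iso_leaky bV bE pr).
Qed.

(** Each isomorphism class of covers is an orbit of numbered covers under renumbering,
    whose stabilizers are the automorphism groups. *)
Theorem leaky_number_polyfun : exists2 phi : ('I_n -> int) -> rat,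
  polyfun (4 * g + n - 3) phi &
  forall x (t : 'I_r -> R), in_domain g k P x -> same_region g k y x ->
    line_graph t -> is_leaky_number k x t (phi x).
Proof.
pose A := size_bound.
have step (ab : 'I_A * 'I_A) := labelled_sum_polyfun ab.1 ab.2.
have [phi pphi ephi] := fin_all_exists2 step.
pose G (ab : 'I_A * 'I_A) : finGroupType := ({perm 'I_ab.1} * {perm 'I_ab.2})%type.
exists (fun x => \sum_ab #|G ab|%:R^-1 * phi ab x).
  by apply: polyfun_sum => ab _; apply: polyfun_scale.
move=> x t xd xr tP.
(* a strict bound for the expansion factors of all covers with few vertices and edges *)
pose N a b (s : shape n r g a b) : int := \sum_v `|excess (c := skeleton R s) k x v|.
pose B := (\sum_(ab : 'I_A * 'I_A) \sum_(s : shape n r g ab.1 ab.2) absz (N _ _ s))%N.+1.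
have ltB (a b : 'I_A) (s : shape n r g a b) :
    \sum_v `|excess (c := skeleton R s) k x v| < B%:Z.
  apply: (@le_lt_trans _ _ (absz (N _ _ s))%:Z); first by rewrite gez0_abs // sumr_ge0.
  rewrite ltz_nat ltnS (bigD1 (a, b)) //= (bigD1 s) //= -addnA.
  exact: leq_addr.
pose T ab := (shape n r g (ab : 'I_A * 'I_A).1 ab.2 * {ffun 'I_ab.2 -> 'I_B})%type.
have reps_ex (ab : 'I_A * 'I_A) := orbit_sum (to := relabel_action n r g ab.1 ab.2 B)
  (fun z pq => leaky_labelled_relabel z pq tP xd) (fun z pq => labelled_weight_relabel t z pq).
have [reps Hreps] := fin_all_exists reps_ex.
pose J := {ab : 'I_A * 'I_A & T ab}.
pose RJ : {set J} := [set j | tagged j \in reps (tag j)].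
pose c (i : 'I_#|RJ|) := cover_of t (tagged (enum_val i)).
have repsL ab z : z \in reps ab -> is_leaky_cover g k x t (cover_of t z).
  by have [/subsetP sub _ _] := Hreps ab => /sub/(leaky_labelledP _ tP xd).
have RJL i : is_leaky_cover g k x t (c i).
  by apply: repsL; have := enum_valP i; rewrite inE.
exists #|RJ|, c, (fun i => #|'C_setT[tagged (enum_val i) | relabel_action n r g _ _ B]%g|%:R^-1
   * labelled_weight t (tagged (enum_val i))); split.
- exact: RJL.
- move=> d dL.
  have [adm exf0 out] := leaky_admissible r_gt0 tP xd dL.
  have edge_lt : (#|edge d| < A)%N.
    rewrite ltnS; apply: leqW; exact: (card_edge_bound exf0 out n_gt0 rE adm).
  have vert_lt : (#|vert d| < A)%N.
    have := betti_card n_gt0 adm; have := card_edge_bound exf0 out n_gt0 rE adm.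
    rewrite /A /size_bound; lia.
  have dB a b (s : shape n r g a b) : #|vert d| = a -> #|edge d| = b ->
     \sum_v `|excess (c := skeleton R s) k x v| < B%:Z.
    move=> av be; rewrite av in vert_lt; rewrite be in edge_lt.
    exact: (ltB (Ordinal vert_lt) (Ordinal edge_lt) s).
  have [z dz] := label_cover r_gt0 tP xd dL dB.
  pose ab : 'I_A * 'I_A := (Ordinal vert_lt, Ordinal edge_lt).
  have zL : z \in leaky_labelled ab.1 ab.2 B x.
    apply/(leaky_labelledP _ tP xd).
    by have [fV [fE [bV bE pr]]] := dz; apply: (iso_leaky bV bE pr).
  have [_ /(_ z zL)[u [[uR uz] u_uniq]] _] := Hreps ab.
  pose j : J := existT T ab u.
  have jR : j \in RJ by rewrite inE.
  exists (enum_rank_in jR j); split.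
    rewrite /c enum_rankK_in //=; apply: isomorphic_trans dz _.
    exact/cover_iso_orbit.
  move=> i di; apply: enum_val_inj; rewrite enum_rankK_in //.
  have iR := enum_valP i; rewrite /c in di; move: (enum_val i) iR di => [ab' z'].
  rewrite inE /= => z'R di.
  have eq_ab : ab' = ab.
    have [fV [fE [bV bE _]]] := di.
    have := bij_eq_card bV; have := bij_eq_card bE; rewrite !card_ord.
    case: (ab') => a' b' /= eb ea; congr (_, _); apply/val_inj; rewrite /= ?ea ?eb //.
  move: z' z'R di; rewrite eq_ab => z' z'R di.
  rewrite /j; congr existT; apply: u_uniq; split=> //.
  apply/cover_iso_orbit; apply: isomorphic_trans (isomorphic_sym dz) di.
- by move=> i; apply: labelled_is_weight tP xd (RJL i).
pose W (j : J) : rat := #|'C_setT[tagged j | relabel_action n r g _ _ B]%g|%:R^-1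
  * labelled_weight t (tagged j).
transitivity (\sum_(j in RJ) W j); last by rewrite big_enum_val.
rewrite (eq_bigl (fun j : J => true && (tagged j \in reps (tag j)))); last first.
  by move=> j; rewrite inE.
rewrite -(sig_big_dep xpredT (fun ab z => z \in reps ab) (fun ab z => 
   #|'C_setT[z | relabel_action n r g _ _ B]%g|%:R^-1 * labelled_weight t z)) /=.
apply: eq_bigr => ab _; have [_ _ ->] := Hreps ab; congr (_ * _).
by rewrite (ephi ab x B t xd xr (ltB ab.1 ab.2)).
Qed.
End Assembly.

(** * The degree of the polynomial *)

Lemma subgroup_index_gt0 d (H : 'rV[int]_d -> Prop) m : subgroup_index H m -> (0 < m)%N.
Proof. by case=> a /(_ 0)[i _]; apply: leq_trans (ltn_ord i). Qed.

Section GenusZero.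
Variables (R : realFieldType) (n : nat) (k : int) (x : 'I_n -> int).
Variable t : 'I_(2 * 0 + n - 2) -> R.

(** In genus 0 there are no vertices of positive genus, so no negative factors. *)
Lemma genus0_weight_gt0 c q : is_leaky_cover 0 k x t c -> is_weight c q -> 0 < q.
Proof.
move=> cL [z [I1 [I2 [_ /subgroup_index_gt0 I1_gt0 /subgroup_index_gt0 I2_gt0 ->]]]].
have gen0 v : gen c v = 0%N.
  by have /esym/eqP := lc_genus cL; rewrite addn_eq0 sum_nat_eq0 => /andP[_ /forallP/(_ v)/eqP].
have -> : [set v : vert c | (gen c v == 1%N) && (valence v == 1%N)] = set0.
  by apply/setP=> v; rewrite !inE gen0.
rewrite cards0 expr0 mulr1; apply: mulr_gt0; last by rewrite ltr0n.
apply: mulr_gt0; last by rewrite ltr0n.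
rewrite invr_gt0 ltr0n; apply/card_gt0P; exists (1%g, 1%g); rewrite inE.
apply/preservesP; split=> [v|e|e|i] /=; by rewrite !perm1.
Qed.

Lemma genus0_leaky_number_gt0 q d :
  is_leaky_cover 0 k x t d -> is_leaky_number k x t q -> 0 < q.
Proof.
move=> dL [m [c [w [cL uniq_c cw ->]]]].
have w_gt0 i := genus0_weight_gt0 (cL i) (cw i).
have [i _] := uniq_c d dL.
rewrite (bigD1 i) //= ltr_wpDr // sumr_ge0 // => j _; exact: ltW.
Qed.
End GenusZero.

Lemma three_ended_cover (R : realFieldType) (k : int) (P : {set 'I_3}) (x : 'I_3 -> int)
    (t : 'I_(2 * 0 + 3 - 2) -> R) :
  line_graph t -> in_domain 0 k P x -> P != set0 -> P != setT ->
  exists d, is_leaky_cover 0 k x t d.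
Proof.
move=> tP xd P0 PT.
pose d : graph_cover R 3 (2 * 0 + 3 - 2) :=
  {| vert := 'I_1; edge := void; gen := fun=> 0%N; lft := of_void _; rgt := of_void _;
     endv := fun=> ord0; len := of_void _; exf := of_void _; pos := fun=> ord0 |}.
have no_edge (Q : pred (edge d)) : #|[set e | Q e]| = 0%N.
  by apply/eqP; rewrite cards_eq0; apply/eqP/setP=> -[].
have val3 v : valence (c := d) v = 3%N.
  rewrite /valence !no_edge (_ : [set i | _] = setT) ?cardsT ?card_ord //.
  by apply/setP=> i; rewrite !inE (ord1 v).
exists d; apply: (admissible_leaky (P := P)) => //.
- apply/and5P; split; last (apply/and4P; split) => //.
  + by apply/forallP=> u; apply/forallP=> v; rewrite (ord1 u) (ord1 v) connect0.
  + by rewrite /betti card_void card_ord big1.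
  + by apply/forallP=> -[].
  + by apply/forallP=> i; case: ifP.
  + by apply/forallP=> v; rewrite val3.
  + by apply/forallP=> j; apply/existsP; exists ord0; rewrite val3 (ord1 j) eqxx.
move=> v; rewrite /outflow !big1 ?subrr //; try by case.
rewrite /excess /euler val3; case: xd => xs _.
rewrite (eq_bigl xpredT) => [|i]; last by rewrite (ord1 v) eqxx.
by rewrite xs subrr.
Qed.

(** The polynomial (sum X_i - a) X_0 ^ m vanishes at all points in question and has
    degree m + 1. *)
Lemma adjust_degree n (a : int) m (p : {mpoly rat[n]}) : (0 < n)%N ->
  (msize p <= m.+2)%N -> exists2 p' : {mpoly rat[n]}, msize p' = m.+2 &
    forall x : 'I_n -> int, \sum_i x i = a ->
      p'.@[fun i => (x i)%:~R] = p.@[fun i => (x i)%:~R].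
Proof.
move=> n_gt0; rewrite leq_eqVlt => /orP[/eqP sp|lt_p]; first by exists p.
pose o := Ordinal n_gt0.
pose l : {mpoly rat[n]} := \sum_i 'X_i - a%:~R%:MP.
have l_coef : l@_(U_(o)) = 1.
  rewrite mcoeffB mcoeffC raddf_sum /= (bigD1 o) //= big1 => [|i /negPf io].
    by rewrite mcoeffXU eqxx addr0 mnm1_eq0 mulr0 subr0.
  by rewrite mcoeffXU io.
have sl : msize l = 2%N.
  apply/eqP; rewrite eqn_leq; apply/andP; split.
    apply: leq_trans (mmeasureD_le _ _ _) _; rewrite mmeasureN geq_max; apply/andP; split.
      apply: leq_trans (mmeasure_sum _ _ _ _) _.
      by apply/bigmax_leqP => i _; rewrite msizeX mdeg1.
    by apply: leq_trans (_ : (1 <= 2)%N); rewrite // mmeasureC; case: (_ != 0).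
  rewrite -[X in (X < _)%N](mdeg1 o); apply: msize_mdeg_lt.
  by rewrite mcoeff_msupp l_coef oner_neq0.
pose h := l * 'X_o ^+ m.
have X0 : ('X_o ^+ m : {mpoly rat[n]}) != 0.
  by rewrite mpolyXn -msize_poly_eq0 msizeX.
have sh : msize h = m.+2.
  rewrite msizeM //; last by rewrite -msize_poly_eq0 sl.
  by rewrite sl mpolyXn msizeX mdegMn mdeg1 mul1n.
exists (h + p).
  apply/eqP; rewrite eqn_leq; apply/andP; split.
    by apply: leq_trans (mmeasureD_le _ _ _) _; rewrite geq_max sh leqnn ltnW.
  have : (msize h <= maxn (msize (h + p)) (msize (- p)))%N.
    by rewrite -{1}[h](addrK p); apply: mmeasureD_le.
  by rewrite mmeasureN sh leq_max => /orP[//|/(leq_trans lt_p)]; rewrite ltnn.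
move=> x xa; rewrite mevalD mevalM (_ : l.@[_] = 0) ?mul0r ?add0r //.
rewrite mevalB mevalC raddf_sum /=.
under eq_bigr do rewrite mevalXU.
by rewrite -rmorph_sum xa subrr.
Qed.

Theorem theorem5p1p1 (R : realFieldType) (g n : nat) (k : int)
    (n_gt0 : (0 < n)%N) (stable_gn : 0 < 2 * g%:Z - 2 + n%:Z)
    (P : {set 'I_n}) (y : 'I_n -> int)
    (y_domain : in_domain g k P y) (y_off : off_walls g k y) :
  exists p : {mpoly rat[n]},
    (msize p = (4 * g + n - 3).+1 \/ (p = 0 /\ (P = set0 \/ P = setT))) /\
    forall x : 'I_n -> int, in_domain g k P x -> same_region g k y x ->
    forall t : 'I_(2 * g + n - 2) -> R, line_graph t ->
      is_leaky_number k x t p.@[fun i => (x i)%:~R].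
Proof.
have r_gt0 : (0 < 2 * g + n - 2)%N by lia.
have [phi pphi ephi] := leaky_number_polyfun R n_gt0 r_gt0 y_domain.
have [p sp ep] := polyfun_mpoly pphi.
case dE : (4 * g + n - 3)%N sp => [|m] sp; last first.
  have [p' sp' ep'] := adjust_degree (k * (2 * g%:Z - 2 + n%:Z)) n_gt0 sp.
  exists p'; split; first by left.
  by move=> x xd xr t tP; rewrite ep'; [rewrite -ep; apply: ephi | case: xd].
have [g0 n3] : g = 0%N /\ n = 3%N by lia.
subst g n.
have [PT|/norP[P0 PT]] := boolP ((P == set0) || (P == setT)).
  exists 0; split; first by right; split=> //; case/orP: PT => /eqP->; [left|right].
  move=> x xd xr t tP; have xL := ephi x t xd xr tP.
  have phi0 : phi x = 0.
    case: (xL) => m [c [w [cL _ _ ->]]]; rewrite big1 // => i _.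
    have [adm _ _] := leaky_admissible r_gt0 tP xd (cL i).
    by have [P0 nT] := adm_proper adm; move: PT; rewrite (negPf P0) (negPf nT).
  by rewrite meval0 -phi0.
exists p; split=> [|x xd xr t tP]; last by rewrite -ep; apply: ephi.
pose t : 'I_(2 * 0 + 3 - 2) -> R := fun=> 0.
have tP : line_graph t by move=> i j; rewrite (ord1 i) (ord1 j).
have [d dL] := three_ended_cover tP y_domain P0 PT.
have := genus0_leaky_number_gt0 dL (ephi y t y_domain (fun _ _ _ _ => erefl) tP).
rewrite ep => p_gt0; left; apply/eqP; rewrite eqn_leq sp lt0n msize_poly_eq0.
by apply: contraTneq p_gt0 => ->; rewrite meval0 ltxx.
Qed.
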